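(* (i) For $N=1$ (solid ball of radius $r_1$), for all sufficiently small $\delta>0$ the equation $\det\mathbf{A}_1(\omega,\delta)=0$ has a root $\omega_{1,1}(\delta)$ with positive real part, depending continuously on $\delta$, with $$\omega_{1,1}(\delta)=\frac{\sqrt3\,v_{\mathrm r}}{r_1}\delta^{1/2}-\mathrm{i}\frac{3v_{\mathrm r}}{2\tau r_1}\delta+O(\delta^{3/2}).$$ (ii) For $N=2$ (spherical shell $r_2<|x|\le r_1$ as resonator, $r_1>r_2>0$), for all sufficiently small $\delta>0$ the equation $\det\mathbf{A}_2(\omega,\delta)=0$ has a root $\omega_{2,1}(\delta)$ with positive real part, depending continuously on $\delta$, with $$\omega_{2,1}(\delta)=\frac{\sqrt{3r_1}\,v_{\mathrm r}}{\sqrt{r_1^3-r_2^3}}\delta^{1/2}-\mathrm{i}\frac{3r_1^2v_{\mathrm r}}{2\tau(r_1^3-r_2^3)}\delta+O(\delta^{3/2}).$$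
   Context: Concentric balls: radii $r_1>r_2>\dots>r_N>0$, $D_0=\{|x|>r_1\}$, $D_j=\{r_{j+1}<|x|\le r_j\}$ ($1\le j\le N-1$), $D_N=\{|x|\le r_N\}$. Odd layers are resonators with density/bulk modulus $\rho_{\mathrm r},\kappa_{\mathrm r}$; even layers (including $D_0$) have $\rho,\kappa$. $v_{\mathrm r}=\sqrt{\kappa_{\mathrm r}/\rho_{\mathrm r}}$, $v=\sqrt{\kappa/\rho}$ are fixed positive constants, $k_{\mathrm r}=\omega/v_{\mathrm r}$, $k=\omega/v$, $\delta=\rho_{\mathrm r}/\rho$, $\tau=v/v_{\mathrm r}$. Let $j(t)=j_0(t)=\sin t/t$ and $h(t)=h^{(1)}_0(t)=-\mathrm{i}e^{\mathrm{i}t}/t$ (spherical Bessel/Hankel functions of order 0), with $'$ denoting $d/dt$. The monopolar ($n=0$) transmission matrix $\mathbf{A}_N(\omega,\delta)$ is the $2N\times2N$ block tridiagonal matrix (unknowns $(a_1,b_1,\dots,a_N,b_N)$) with $2\times2$ diagonal blocks $M_i$ ($1\le i\le N$), superdiagonal blocks $R_i$ ($1\le i\le N-1$) and subdiagonal blocks $L_i$ ($2\le i\le N$), where for $i$ odd: $M_i=\begin{pmatrix}-h(kr_i)&j(k_{\mathrm r}r_i)\\-\delta h'(kr_i)&\tau j'(k_{\mathrm r}r_i)\end{pmatrix}$, $R_i=\begin{pmatrix}h(k_{\mathrm r}r_i)&0\\ \tau h'(k_{\mathrm r}r_i)&0\end{pmatrix}$, $L_i=\begin{pmatrix}0&-j(kr_i)\\0&-\delta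 j'(kr_i)\end{pmatrix}$; for $i$ even: $M_i=\begin{pmatrix}-h(k_{\mathrm r}r_i)&j(kr_i)\\-\tau h'(k_{\mathrm r}r_i)&\delta j'(kr_i)\end{pmatrix}$, $R_i=\begin{pmatrix}h(kr_i)&0\\ \delta h'(kr_i)&0\end{pmatrix}$, $L_i=\begin{pmatrix}0&-j(k_{\mathrm r}r_i)\\0&-\tau j'(k_{\mathrm r}r_i)\end{pmatrix}$. Roots $\omega$ of $\det\mathbf{A}_N(\omega,\delta)=0$ with $\omega\to0$ as $\delta\to0$ are the monopolar subwavelength resonant frequencies. *)

(* Defs.v *)
From HB Require Import structures.
From mathcomp Require Import all_boot all_order all_algebra.
From mathcomp Require Import complex.
From mathcomp Require Import reals.
From mathcomp.analysis Require Import sequences exp trigo.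
Set Implicit Arguments. Unset Strict Implicit. Unset Printing Implicit Defensive.
Import Order.TTheory GRing.Theory Num.Theory.
Local Open Scope ring_scope.
Local Open Scope complex_scope.

Section Defs.
Variable R : realType.

Definition Cexp (z : R[i]) : R[i] :=
  (expR (complex.Re z) * cos (complex.Im z)) +i* (expR (complex.Re z) * sin (complex.Im z)).
Definition Csin (z : R[i]) : R[i] := (Cexp ('i * z) - Cexp (- ('i * z))) / (2%:R * 'i).
Definition Ccos (z : R[i]) : R[i] := (Cexp ('i * z) + Cexp (- ('i * z))) / 2%:R.

(* spherical Bessel j_0(t) = sin t / t and its derivative *)
Definition sj (t : R[i]) : R[i] := Csin t / t.
Definition sj' (t : R[i]) : R[i] := Ccos t / t - Csin t / (t ^+ 2).
(* spherical Hankel h_0^(1)(t) = -i e^{it}/t and its derivative *)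
Definition sh (t : R[i]) : R[i] := - 'i * Cexp ('i * t) / t.
Definition sh' (t : R[i]) : R[i] := Cexp ('i * t) / t + 'i * Cexp ('i * t) / (t ^+ 2).

Definition e2 (p q : bool) (a00 a01 a10 a11 : R[i]) : R[i] :=
  if p then (if q then a11 else a10) else (if q then a01 else a00).

Section Blocks.
Variables (vr v : R) (r : nat -> R) (delta : R) (w : R[i]).
Let k := w / v%:C.
Let kr := w / vr%:C.
Let tau : R[i] := (v / vr)%:C.
Let dl : R[i] := delta%:C.

Definition Mblk (i : nat) (p q : bool) : R[i] :=
  let ri := (r i)%:C in
  if odd i then e2 p q (- sh (k * ri)) (sj (kr * ri))
                       (- dl * sh' (k * ri)) (tau * sj' (kr * ri))
  else e2 p q (- sh (kr * ri)) (sj (k * ri))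
              (- tau * sh' (kr * ri)) (dl * sj' (k * ri)).

Definition Rblk (i : nat) (p q : bool) : R[i] :=
  let ri := (r i)%:C in
  if odd i then e2 p q (sh (kr * ri)) 0 (tau * sh' (kr * ri)) 0
  else e2 p q (sh (k * ri)) 0 (dl * sh' (k * ri)) 0.

Definition Lblk (i : nat) (p q : bool) : R[i] :=
  let ri := (r i)%:C in
  if odd i then e2 p q 0 (- sj (k * ri)) 0 (- dl * sj' (k * ri))
  else e2 p q 0 (- sj (kr * ri)) 0 (- tau * sj' (kr * ri)).

(* The 2N x 2N block tridiagonal transmission matrix A_N(omega, delta):
   row a lies in block I = a/2 + 1 (1-based), row a mod 2 inside it;
   similarly for columns. *)
Definition transA (N : nat) : 'M[R[i]]_(2 * N) :=
  \matrix_(a < 2 * N, b < 2 * N)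
    let I := (a %/ 2).+1 in let J := (b %/ 2).+1 in
    let p := odd a in let q := odd b in
    if J == I then Mblk I p q
    else if J == I.+1 then Rblk I p q
    else if I == J.+1 then Lblk I p q
    else 0.
End Blocks.

Definition ccont_on (d0 : R) (f : R -> R[i]) : Prop :=
  forall d, 0 < d < d0 -> forall e : R, 0 < e -> exists2 eta : R, 0 < eta &
    forall d', 0 < d' < d0 -> `|d' - d| < eta -> Normc.normc (f d' - f d) < e.

End Defs.

(* Main.v *)
Require Import Defs.
From HB Require Import structures.
From mathcomp Require Import all_boot all_order all_algebra.
From mathcomp Require Import complex ring lra.
From mathcomp Require Import boolp classical_sets functions reals topology normedtype.
From mathcomp.analysis Require Import sequences derive realfun exp trigo.
Set Implicit Arguments. Unset Strict Implicit. Unset Printing Implicit Defensive.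
Import Order.TTheory GRing.Theory Num.Theory numFieldNormedType.Exports.
Local Open Scope ring_scope.
Local Open Scope complex_scope.

(** With y_i = k_r r_i and x_i = k r_i, clearing denominators and the factors
    that cannot vanish reduces the determinant to
      D = (y_1 y_2 + A B) sin (y_1 - y_2) - (B y_1 - A y_2) cos (y_1 - y_2),
    where A = 1 - delta (1 - i x_1) and B = 1 + delta (x_2 cot x_2 - 1); a single
    layer is the degenerate case y_2 = 0, B = 1.  Put s = sqrt delta and w = s z.
    Taylor expansion gives
      D / (M s^3 z) = z^2 - c^2 (1 - i s R_1 z / tau) + O(s^2),
    where R_i = r_i / v_r, M = (R_1^3 - R_2^3) / 3 and c^2 = R_1 / M, the remainder
    being also O(s^2)-Lipschitz in z near c.  Newton's map with frozen slope 2c is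
    therefore a contraction of the disc |z - c| <= c / 4; its fixed point is the
    root, it is continuous in s, and feeding z = c + O(s) back into the equation
    yields z = c - i c^2 R_1 s / (2 tau) + O(s^2). *)

Local Notation normc := Normc.normc.

(* [lra] does not identify convertible [normc] atoms, so they are abstracted first. *)
Ltac normc_lra :=
  repeat match goal with
  | |- context [Normc.normc ?z] => let n := fresh "n" in set n := (Normc.normc z); move: n => n
  end; lra.

(** * Modulus, real and imaginary parts, and the complex exponential *)

Section Normc.
Variable R : realType.
Implicit Types z w : R[i].

Lemma normc_norm z : (normc z)%:C = `|z|.
Proof. by []. Qed.

Lemma normcD z w : normc (z + w) <= normc z + normc w.
Proof. by rewrite -lecR rmorphD /= !normc_norm ler_normD. Qed.

Lemma normc_ge0 z : 0 <= normc z.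
Proof. by case: z => a b; rewrite sqrtr_ge0. Qed.

Lemma normcN z : normc (- z) = normc z.
Proof. by apply: complexI; rewrite !normc_norm normrN. Qed.

Lemma normc_distC z w : normc (z - w) = normc (w - z).
Proof. by rewrite -normcN opprB. Qed.

Lemma normcX z n : normc (z ^+ n) = normc z ^+ n.
Proof. by apply: complexI; rewrite rmorphXn /= !normc_norm normrX. Qed.

Lemma normcR (a : R) : normc a%:C = `|a|.
Proof. by rewrite /= expr0n addr0 sqrtr_sqr. Qed.

Lemma normci : normc ('i%R : R[i]) = 1.
Proof. by change (normc (0 +i* 1 : R[i]) = 1); rewrite /= expr0n add0r expr1n sqrtr1. Qed.

Lemma Re_add z w : complex.Re (z + w) = complex.Re z + complex.Re w.
Proof. by case: z w => [? ?] [? ?]. Qed.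

Lemma Im_add z w : complex.Im (z + w) = complex.Im z + complex.Im w.
Proof. by case: z w => [? ?] [? ?]. Qed.

Lemma Re_sub z w : complex.Re (z - w) = complex.Re z - complex.Re w.
Proof. by case: z w => [? ?] [? ?]. Qed.

Lemma Im_sub z w : complex.Im (z - w) = complex.Im z - complex.Im w.
Proof. by case: z w => [? ?] [? ?]. Qed.

Lemma Re_mul z w :
  complex.Re (z * w) = complex.Re z * complex.Re w - complex.Im z * complex.Im w.
Proof. by case: z w => [? ?] [? ?]. Qed.

Lemma Im_mul z w :
  complex.Im (z * w) = complex.Re z * complex.Im w + complex.Im z * complex.Re w.
Proof. by case: z w => [? ?] [? ?] /=; rewrite addrC. Qed.

Lemma Re_le_normc z : `|complex.Re z| <= normc z.
Proof.
case: z => a b /=; rewrite -sqrtr_sqr ler_wsqrtr // lerDl; exact: sqr_ge0.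
Qed.

Lemma Im_le_normc z : `|complex.Im z| <= normc z.
Proof.
case: z => a b /=; rewrite -sqrtr_sqr ler_wsqrtr // lerDr; exact: sqr_ge0.
Qed.

Lemma normc_le_ReIm z : normc z <= `|complex.Re z| + `|complex.Im z|.
Proof.
case: z => a b; have -> : a +i* b = a%:C + 'i * b%:C by simpc.
apply: le_trans (normcD _ _) _; rewrite Normc.normcM normci mul1r !normcR; simpc.
by rewrite lexx.
Qed.

Lemma normc0_eq0 z : normc z <= 0 -> z = 0.
Proof.
by move=> h; apply: Normc.eq0_normc; apply/eqP; rewrite eq_le h normc_ge0.
Qed.

Lemma normc_distD w z1 z2 : normc (z1 - z2) <= normc (z1 - w) + normc (w - z2).
Proof. by rewrite -[z1 - z2](subrKA w) normcD. Qed.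

Lemma CexpD z w : Cexp (z + w) = Cexp z * Cexp w.
Proof.
case: z w => [a b] [c d]; rewrite /Cexp /= expRD cosD sinD; simpc.
by congr (_ +i* _); ring.
Qed.

Lemma Cexp0 : Cexp 0 = 1 :> R[i].
Proof. by rewrite /Cexp /= expR0 cos0 sin0 mulr1 mulr0. Qed.

Lemma normc_Cexp z : normc (Cexp z) = expR (complex.Re z).
Proof.
rewrite /Cexp /= !exprMn -mulrDr cos2Dsin2 mulr1 sqrtr_sqr.
by rewrite ger0_norm // expR_ge0.
Qed.

End Normc.

(** * Pointwise derivative rules for real functions *)

Section RealDerivative.
Variable R : realType.
Implicit Types (f g : R -> R) (t : R).

Lemma is_derive1_eq f t (df df' : R) : is_derive t 1 f df -> df = df' ->
  is_derive t 1 f df'.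
Proof. by move=> h <-. Qed.

Lemma is_derive1D f g t (df dg : R) : is_derive t 1 f df -> is_derive t 1 g dg ->
  is_derive t 1 (fun u => f u + g u) (df + dg).
Proof. by move=> hf hg; exact: is_deriveD. Qed.

Lemma is_derive1B f g t (df dg : R) : is_derive t 1 f df -> is_derive t 1 g dg ->
  is_derive t 1 (fun u => f u - g u) (df - dg).
Proof. by move=> hf hg; exact: is_deriveB. Qed.

Lemma is_derive1M f g t (df dg : R) : is_derive t 1 f df -> is_derive t 1 g dg ->
  is_derive t 1 (fun u => f u * g u) (df * g t + f t * dg).
Proof.
move=> hf hg; have h := is_deriveM hf hg.
by rewrite addrC mulrC [df * _]mulrC [dg * _]mulrC.
Qed.

Lemma is_derive_affine (x y t : R) : is_derive t 1 (fun u => x + u * y) y.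
Proof.
have h1 : is_derive t 1 (fun=> x) (0 : R) by exact: is_derive_cst.
have h2 : is_derive t 1 (fun=> y) (0 : R) by exact: is_derive_cst.
have h3 : is_derive t 1 (@id R) 1 by exact: is_derive_id.
have := is_derive1D h1 (is_derive1M h3 h2).
by rewrite mul1r mulr0 addr0 add0r.
Qed.
End RealDerivative.

(** * Complex derivatives and a mean value inequality *)

Section ComplexDerivative.
Variable R : realType.
Implicit Types f g : R[i] -> R[i].

(* Differentiating along real lines reduces everything to derivatives of real functions. *)
Definition cderiv f f' := forall (a b : R[i]) (t : R),
  is_derive t 1 (fun t => complex.Re (f (a + t%:C * b)))
    (complex.Re (b * f' (a + t%:C * b))) /\
  is_derive t 1 (fun t => complex.Im (f (a + t%:C * b)))
    (complex.Im (b * f' (a + t%:C * b))).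

Lemma cderiv_cst (c : R[i]) : cderiv (fun=> c) (fun=> 0).
Proof. by move=> a b t; rewrite mulr0 /=; split; exact: is_derive_cst. Qed.

Lemma cderivD f g f' g' : cderiv f f' -> cderiv g g' ->
  cderiv (fun z => f z + g z) (fun z => f' z + g' z).
Proof.
move=> hf hg a b t; have [h1 h2] := hf a b t; have [h3 h4] := hg a b t.
rewrite mulrDr Re_add Im_add; split.
- rewrite (_ : (fun u : R => _) = (fun u : R =>
    complex.Re (f (a + u%:C * b)) + complex.Re (g (a + u%:C * b)))).
    exact: is_derive1D.
  by apply/funext => u; rewrite Re_add.
- rewrite (_ : (fun u : R => _) = (fun u : R =>
    complex.Im (f (a + u%:C * b)) + complex.Im (g (a + u%:C * b)))).
    exact: is_derive1D.
  by apply/funext => u; rewrite Im_add.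
Qed.

Lemma cderivM f g f' g' : cderiv f f' -> cderiv g g' ->
  cderiv (fun z => f z * g z) (fun z => f' z * g z + f z * g' z).
Proof.
move=> hf hg a b t; have [h1 h2] := hf a b t; have [h3 h4] := hg a b t.
split.
- rewrite (_ : (fun u : R => _) = (fun u : R =>
    complex.Re (f (a + u%:C * b)) * complex.Re (g (a + u%:C * b))
    - complex.Im (f (a + u%:C * b)) * complex.Im (g (a + u%:C * b)))); last first.
    by apply/funext => u; rewrite Re_mul.
  apply: (is_derive1_eq (is_derive1B (is_derive1M h1 h3) (is_derive1M h2 h4)) _).
  by rewrite mulrDr Re_add !(Re_mul, Im_mul); ring.
- rewrite (_ : (fun u : R => _) = (fun u : R =>
    complex.Re (f (a + u%:C * b)) * complex.Im (g (a + u%:C * b))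
    + complex.Im (f (a + u%:C * b)) * complex.Re (g (a + u%:C * b)))); last first.
    by apply/funext => u; rewrite Im_mul.
  apply: (is_derive1_eq (is_derive1D (is_derive1M h1 h4) (is_derive1M h2 h3)) _).
  by rewrite mulrDr Im_add !(Re_mul, Im_mul); ring.
Qed.

Lemma Re_affine (a b : R[i]) (u : R) :
  complex.Re (a + u%:C * b) = complex.Re a + u * complex.Re b.
Proof. by rewrite Re_add Re_mul /= mul0r subr0. Qed.

Lemma Im_affine (a b : R[i]) (u : R) :
  complex.Im (a + u%:C * b) = complex.Im a + u * complex.Im b.
Proof. by rewrite Im_add Im_mul /= mul0r addr0. Qed.

Lemma cderiv_ext f f' g' : cderiv f f' -> f' =1 g' -> cderiv f g'.
Proof. by move=> h e a b t; rewrite -e. Qed.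

Lemma cderiv_id : cderiv id (fun=> 1).
Proof.
move=> a b t; rewrite mulr1.
have -> : (fun t0 : R => complex.Re (id (a + t0%:C * b))) =
    (fun u => complex.Re a + u * complex.Re b).
  by apply/funext => u; exact: Re_affine.
have -> : (fun t0 : R => complex.Im (id (a + t0%:C * b))) =
    (fun u => complex.Im a + u * complex.Im b).
  by apply/funext => u; exact: Im_affine.
by split; exact: is_derive_affine.
Qed.

Lemma cderivX n : cderiv (fun z => z ^+ n.+1) (fun z => n.+1%:R * z ^+ n).
Proof.
elim: n => [|n ih].
  by apply: cderiv_ext cderiv_id _ => z; rewrite mulr1.
have := cderivM cderiv_id ih.
have -> : (fun z : R[i] => id z * z ^+ n.+1) = (fun z => z ^+ n.+2).
  by apply/funext => z; rewrite [RHS]exprS.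
move/cderiv_ext; apply => z.
rewrite /= mul1r mulrCA -exprS -[in RHS]nat1r mulrDl mul1r. by [].
Qed.

Lemma cderiv_Cexp : cderiv (@Cexp R) (@Cexp R).
Proof.
move=> a b t.
have he := is_derive1_comp (is_derive_expR _) (is_derive_affine (complex.Re a) (complex.Re b) t).
have hc := is_derive1_comp (is_derive_cos _) (is_derive_affine (complex.Im a) (complex.Im b) t).
have hs := is_derive1_comp (is_derive_sin _) (is_derive_affine (complex.Im a) (complex.Im b) t).
split.
- rewrite (_ : (fun u : R => complex.Re (Cexp (a + u%:C * b))) = (fun u : R =>
    expR (complex.Re a + u * complex.Re b) * cos (complex.Im a + u * complex.Im b))); last first.
    by apply/funext => u; rewrite /Cexp Re_affine Im_affine.
  apply: (is_derive1_eq (is_derive1M he hc) _).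
  by rewrite Re_mul /Cexp /= Re_affine Im_affine; ring.
- rewrite (_ : (fun u : R => complex.Im (Cexp (a + u%:C * b))) = (fun u : R =>
    expR (complex.Re a + u * complex.Re b) * sin (complex.Im a + u * complex.Im b))); last first.
    by apply/funext => u; rewrite /Cexp Re_affine Im_affine.
  apply: (is_derive1_eq (is_derive1M he hs) _).
  by rewrite Im_mul /Cexp /= Re_affine Im_affine; ring.
Qed.

Lemma real_mean_value (g dg : R -> R) (B : R) :
  (forall t : R, is_derive t 1 g (dg t)) ->
  (forall t, 0 <= t <= 1 -> `|dg t| <= B) -> `|g 1 - g 0| <= B.
Proof.
move=> hg hB.
have [|c] := @MVT_segment R g dg 0 1 ler01 (fun x _ => hg x).
  apply: derivable_within_continuous => x _.
  by have := hg x; case.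
by rewrite in_itv /= => hc ->; rewrite subr0 mulr1 hB.
Qed.

(** The mean value theorem in equality form fails for complex values, so it is applied to the real
    and imaginary parts separately along the segment from [z'] to [z]; adding the two bounds costs
    the factor 2. *)
Lemma cderiv_lipschitz f f' (B : R) (z z' : R[i]) : cderiv f f' ->
  (forall t, 0 <= t <= 1 -> normc (f' (z' + t%:C * (z - z'))) <= B) ->
  normc (f z - f z') <= 2%:R * (B * normc (z - z')).
Proof.
move=> hf hB; have hd := hf z' (z - z').
have hb t : 0 <= t <= 1 -> normc ((z - z') * f' (z' + t%:C * (z - z'))) <= B * normc (z - z').
  by move=> ht; rewrite Normc.normcM mulrC ler_wpM2r ?normc_ge0 ?hB.
have e1 : z' + 1%:C * (z - z') = z by rewrite mul1r addrC subrK.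
have e0 : z' + 0%:C * (z - z') = z' by rewrite mul0r addr0.
have h1 := real_mean_value (fun t => proj1 (hd t))
  (fun t ht => le_trans (Re_le_normc _) (hb t ht)).
have h2 := real_mean_value (fun t => proj2 (hd t))
  (fun t ht => le_trans (Im_le_normc _) (hb t ht)).
rewrite /= e1 e0 in h1 h2.
apply: le_trans (normc_le_ReIm _) _.
by rewrite mulr_natl mulr2n !raddfB lerD.
Qed.

End ComplexDerivative.

(** * Taylor remainders of the exponential *)

Section Remainder.
Variable R : realType.
Implicit Types z w : R[i].

Definition Cexp_rem n z : R[i] := Cexp z - \sum_(k < n) z ^+ k / k`!%:R.

Lemma cderiv_exp_sum n :
  cderiv (fun z : R[i] => \sum_(k < n.+1) z ^+ k / k`!%:R)
         (fun z => \sum_(k < n) z ^+ k / k`!%:R).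
Proof.
elim: n => [|n ih].
  have -> : (fun z : R[i] => \sum_(k < 1) z ^+ k / k`!%:R) = (fun=> 1).
    by apply/funext => z; rewrite big_ord1 expr0 fact0 divr1.
  have := @cderiv_cst R 1; move/cderiv_ext; apply => z; by rewrite big_ord0.
have -> : (fun z : R[i] => \sum_(k < n.+2) z ^+ k / k`!%:R) =
  (fun z : R[i] => \sum_(k < n.+1) z ^+ k / k`!%:R + z ^+ n.+1 * (n.+1)`!%:R^-1).
  by apply/funext => z; rewrite big_ord_recr.
have := cderivD ih (cderivM (cderivX (R := R) n) (cderiv_cst (n.+1)`!%:R^-1)).
move/cderiv_ext; apply => z.
rewrite big_ord_recr /= mulr0 addr0 factS natrM invfM.
by congr (_ + _); rewrite mulrACA divff ?mul1r ?pnatr_eq0.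
Qed.

Lemma cderiv_Cexp_rem n : cderiv (Cexp_rem n.+1) (Cexp_rem n).
Proof.
have h := cderivM (cderiv_cst (-1 : R[i])) (cderiv_exp_sum n).
have := cderivD (cderiv_Cexp (R := R)) h.
have -> : (fun z : R[i] => Cexp z + -1 * \sum_(k < n.+1) z ^+ k / k`!%:R) = Cexp_rem n.+1.
  by apply/funext => z; rewrite mulN1r.
by move/cderiv_ext; apply => z; rewrite mul0r add0r mulN1r.
Qed.

Lemma Cexp_rem0 n : Cexp_rem n.+1 0 = 0.
Proof.
rewrite /Cexp_rem Cexp0 big_ord_recl expr0 fact0 divr1 big1 ?addr0 ?subrr // => i _.
by rewrite expr0n mul0r.
Qed.

Lemma normc_segment z w (r t : R) : normc z <= r -> normc w <= r -> 0 <= t <= 1 ->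
  normc (w + t%:C * (z - w)) <= r.
Proof.
move=> hz hw /andP[t0 t1].
have -> : w + t%:C * (z - w) = (1 - t)%:C * w + t%:C * z.
  by rewrite rmorphB rmorph1; ring.
apply: le_trans (normcD _ _) _.
rewrite !Normc.normcM !normcR ger0_norm ?subr_ge0 // ger0_norm //.
have h1 : (1 - t) * normc w <= (1 - t) * r by rewrite ler_wpM2l ?subr_ge0.
have h2 : t * normc z <= t * r by rewrite ler_wpM2l.
apply: le_trans (lerD h1 h2) _.
by rewrite -mulrDl subrK mul1r.
Qed.

(** Induction by integration: [Cexp_rem n.+1] vanishes at 0 and has derivative [Cexp_rem n], so the
    mean value inequality on the segment from 0 gains one power of [normc z]. The constant starts at
    e and doubles at each step. *)
Lemma Cexp_rem_le n : exists2 K : R, 0 <= K &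
  forall z, normc z <= 1 -> normc (Cexp_rem n z) <= K * normc z ^+ n.
Proof.
elim: n => [|n [K K0 hK]].
  exists (expR 1); first exact: expR_ge0.
  move=> z hz; rewrite /Cexp_rem big_ord0 subr0 normc_Cexp expr0 mulr1 ler_expR.
  by apply: le_trans hz; apply: le_trans (Re_le_normc z); exact: ler_norm.
exists (2%:R * K); first by rewrite mulr_ge0.
move=> z hz; have := @cderiv_lipschitz R _ _ (K * normc z ^+ n) z 0 (cderiv_Cexp_rem n).
rewrite Cexp_rem0 !subr0 => h; apply: le_trans (h _) _; last first.
  by rewrite exprSr !mulrA.
move=> t ht; have hs : normc (0 + t%:C * (z - 0)) <= normc z.
  by apply: normc_segment => //; rewrite Normc.normc0 normc_ge0.
rewrite subr0 in hs.
apply: le_trans (hK _ (le_trans hs hz)) _.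
by rewrite ler_wpM2l // lerXn2r // nnegrE normc_ge0.
Qed.

(** The derivative [Cexp_rem n] is of size [r ^+ n] on the whole segment, which stays in the disc of
    radius [r]. The smallness of this Lipschitz constant is what lets Taylor errors enter a
    contraction. *)
Lemma Cexp_rem_lipschitz n : exists2 K : R, 0 <= K & forall (r : R) z w,
  r <= 1 -> normc z <= r -> normc w <= r ->
  normc (Cexp_rem n.+1 z - Cexp_rem n.+1 w) <= K * r ^+ n * normc (z - w).
Proof.
have [K K0 hK] := Cexp_rem_le n.
exists (2%:R * K); first by rewrite mulr_ge0.
move=> r z w r1 hz hw.
rewrite -!mulrA mulrA -mulrA [K * _]mulrA.
apply: cderiv_lipschitz (cderiv_Cexp_rem n) _ => t ht.
have hs := normc_segment hz hw ht.
apply: le_trans (hK _ (le_trans hs r1)) _.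
rewrite ler_wpM2l // lerXn2r // nnegrE ?normc_ge0 //.
exact: le_trans (normc_ge0 _) hs.
Qed.

End Remainder.

(** * A contraction principle on a complex disc *)

Section FixedPoint.
Variable R : realType.

(** Replaces passing to the limit in estimates along the iteration. *)
Lemma le_add_geometric (x y K : R) : (forall n, x <= y + K / 2%:R ^+ n) -> x <= y.
Proof.
move=> h; rewrite leNgt; apply/negP => hlt.
have d0 : 0 < x - y by rewrite subr_gt0.
have K0 : 0 < K.
  have := h 0%N; rewrite expr0 divr1 => h0; rewrite -(ltrD2l y) addr0.
  exact: lt_le_trans hlt h0.
(* Since n < 2^n, this [n] makes K / 2^n smaller than the gap x - y. *)
have [n hn] : exists n : nat, K / (x - y) < n%:R.
  exists (Num.truncn (K / (x - y))).+1; exact: truncnS_gt.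
have hn2 : (n%:R : R) <= 2%:R ^+ n by rewrite -natrX ler_nat ltnW // ltn_expl.
have := h n; rewrite -lerBlDl ler_pdivlMr ?exprn_gt0 // => hh.
have : K < K.
  apply: lt_le_trans hh.
  rewrite -ltr_pdivrMl // mulrC; exact: lt_le_trans hn hn2.
by rewrite ltxx.
Qed.

(** The intervals [b n, c n] of half-width 2 K / 2^n around [a n] are nested: a step is at most K /
    2^n, and the half-width drops by exactly that amount. The supremum of the left ends lies in all
    of them. *)
Lemma geometric_cauchy (a : nat -> R) (K : R) :
  (forall n, `|a n.+1 - a n| <= K / 2%:R ^+ n) ->
  exists l, forall n, `|l - a n| <= 2%:R * K / 2%:R ^+ n.
Proof.
move=> h; pose b n := a n - 2%:R * K / 2%:R ^+ n; pose c n := a n + 2%:R * K / 2%:R ^+ n.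
have hKS n : 2%:R * K / 2%:R ^+ n.+1 = K / 2%:R ^+ n.
  by rewrite exprS invfM mulrACA divff ?mul1r // pnatr_eq0.
have hK2 n : 2%:R * K / 2%:R ^+ n = K / 2%:R ^+ n + K / 2%:R ^+ n.
  by rewrite -mulrA mulr_natl mulr2n.
have hb n : b n <= b n.+1.
  rewrite /b hKS hK2; have := h n; rewrite ler_norml => /andP[h1 _]; lra.
have hc n : c n.+1 <= c n.
  rewrite /c hKS hK2; have := h n; rewrite ler_norml => /andP[_ h1]; lra.
have hbm := homo_leq (r := fun x y : R => x <= y) (@lexx _ _) (fun y x z => @le_trans _ _ y x z) hb.
have hcm := homo_leq (r := fun x y : R => y <= x) (@lexx _ _)
  (fun y x z h1 h2 => @le_trans _ _ y z x h2 h1) hc.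
have K0 : 0 <= K.
  by have := le_trans (normr_ge0 _) (h 0%N); rewrite expr0 divr1.
have hbc0 n : b n <= c n.
  have : 0 <= 2%:R * K / 2%:R ^+ n by rewrite divr_ge0 ?mulr_ge0 ?exprn_ge0.
  rewrite /b /c; lra.
have hbc n m : b n <= c m.
  case: (leqP n m) => hnm.
    exact: le_trans (hbm _ _ hnm) (hbc0 _).
  exact: le_trans (hbc0 _) (hcm _ _ (ltnW hnm)).
pose A := range b.
have hub m : ubound A (c m) by move=> _ [n _ <-].
exists (sup A) => n.
have h1 : b n <= sup A.
  by apply: ub_le_sup; [exists (c 0%N); exact: hub | exists n].
have h2 : sup A <= c n.
  by apply: ge_sup; [exists (b 0%N), 0%N | exact: hub].
rewrite ler_norml; move: h1 h2; rewrite /b /c => h1 h2; apply/andP; split; lra.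
Qed.

(** Picard iteration from the centre: steps are at most rho / 2^n, so the real and imaginary parts
    converge by [geometric_cauchy], and the limit stays in the disc. *)
Lemma contraction_fixed_point (F : R[i] -> R[i]) (c : R[i]) (rho : R) :
  (forall z, normc (z - c) <= rho -> normc (F z - c) <= rho) ->
  (forall z w, normc (z - c) <= rho -> normc (w - c) <= rho ->
     normc (F z - F w) <= normc (z - w) / 2%:R) -> 0 <= rho ->
  exists2 z, normc (z - c) <= rho & F z = z.
Proof.
move=> hball hctr rho0; pose u n := iter n F c.
have hu n : normc (u n - c) <= rho.
  by elim: n => [|n ih]; [rewrite subrr Normc.normc0 | exact: hball].
have hstep n : normc (u n.+1 - u n) <= rho / 2%:R ^+ n.
  elim: n => [|n ih]; first by rewrite expr0 divr1; exact: hball (hu 0%N).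
  apply: le_trans (hctr _ _ (hu n.+1) (hu n)) _.
  by rewrite exprSr invfM mulrA ler_wpM2r ?invr_ge0.
have [n|x hx] := @geometric_cauchy (fun n => complex.Re (u n)) rho.
  by rewrite -Re_sub; apply: le_trans (Re_le_normc _) (hstep n).
have [n|y hy] := @geometric_cauchy (fun n => complex.Im (u n)) rho.
  by rewrite -Im_sub; apply: le_trans (Im_le_normc _) (hstep n).
pose l := x +i* y.
have hl n : normc (l - u n) <= 4%:R * rho / 2%:R ^+ n.
  apply: le_trans (normc_le_ReIm _) _.
  have -> : 4%:R * rho / 2%:R ^+ n = 2%:R * rho / 2%:R ^+ n + 2%:R * rho / 2%:R ^+ n.
    by rewrite -!mulrDl; congr (_ * _ / _); rewrite -natrD.
  have := lerD (hx n) (hy n); by rewrite /l; case: (u n).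
have lc : normc (l - c) <= rho.
  apply: (@le_add_geometric _ _ (4%:R * rho)) => n.
  apply: le_trans (normc_distD (u n) _ _) _.
  by rewrite addrC lerD.
exists l => //; apply/eqP; rewrite -subr_eq0; apply/eqP/normc0_eq0.
(* Both F l - u (n+1) and u (n+1) - l are at most half of 4 rho / 2^n, the first by contraction, the
   second by the rate of convergence. *)
apply: (@le_add_geometric _ _ (4%:R * rho)) => n.
apply: le_trans (normc_distD (u n.+1) _ _) _.
rewrite add0r.
have h1 := hctr _ _ lc (hu n).
have h2 := hl n; have h3 := hl n.+1.
rewrite normc_distC in h3.
have e : 4%:R * rho / 2%:R ^+ n.+1 = 4%:R * rho / 2%:R ^+ n / 2%:R.
  by rewrite exprSr invfM mulrA.
rewrite e in h3; change (F (u n)) with (u n.+1) in h1.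
by move: h1 h2 h3; lra.
Qed.

End FixedPoint.

(** * Pointwise continuity of complex functions of a real variable *)

Section ContinuousAt.
Variable R : realType.
Implicit Types f g : R -> R[i].

(** Componentwise, so that continuity lemmas for real functions apply directly; [ccontP] recovers
    the epsilon-eta form used in [ccont_on]. *)
Definition ccont f (s : R) :=
  {for s, continuous (fun x => complex.Re (f x))} /\
  {for s, continuous (fun x => complex.Im (f x))}.

Lemma ccont_cst (c : R[i]) s : ccont (fun=> c) s.
Proof. by split; exact: cvg_cst. Qed.

Lemma ccont_real (h : R -> R) s : {for s, continuous h} -> ccont (fun x => (h x)%:C) s.
Proof. by move=> hs; split => //=; exact: cvg_cst. Qed.

Lemma ccontD f g s : ccont f s -> ccont g s -> ccont (fun x => f x + g x) s.
Proof.
move=> [f1 f2] [g1 g2]; split.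
- rewrite (_ : (fun x => _) = (fun x => complex.Re (f x)) + (fun x => complex.Re (g x))).
    exact: continuousD.
  by apply/funext => x; rewrite Re_add.
- rewrite (_ : (fun x => _) = (fun x => complex.Im (f x)) + (fun x => complex.Im (g x))).
    exact: continuousD.
  by apply/funext => x; rewrite Im_add.
Qed.

Lemma ccontM f g s : ccont f s -> ccont g s -> ccont (fun x => f x * g x) s.
Proof.
move=> [f1 f2] [g1 g2]; split.
- rewrite (_ : (fun x => _) = ((fun x => complex.Re (f x)) \* (fun x => complex.Re (g x)))
    - ((fun x => complex.Im (f x)) \* (fun x => complex.Im (g x)))).
    by apply: continuousB; exact: continuousM.
  by apply/funext => x; rewrite Re_mul.
- rewrite (_ : (fun x => _) = ((fun x => complex.Re (f x)) \* (fun x => complex.Im (g x)))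
    + ((fun x => complex.Im (f x)) \* (fun x => complex.Re (g x)))).
    by apply: continuousD; exact: continuousM.
  by apply/funext => x; rewrite Im_mul.
Qed.

Lemma ccontN f s : ccont f s -> ccont (fun x => - f x) s.
Proof.
move=> h; rewrite (_ : (fun x => _) = (fun x => -1 * f x)).
  exact: ccontM (ccont_cst _ _) h.
by apply/funext => x; rewrite mulN1r.
Qed.

(** The inverse is the conjugate divided by the squared modulus [n], which is continuous and nonzero
    at [s]. *)
Lemma ccontV f s : f s != 0 -> ccont f s -> ccont (fun x => (f x)^-1) s.
Proof.
move=> f0 [f1 f2].
pose n x := (complex.Re (f x)) ^+ 2 + (complex.Im (f x)) ^+ 2.
have n0 : n s != 0.
  apply: contra f0; rewrite /n; case: (f s) => a b /=.
  by rewrite paddr_eq0 ?sqr_ge0 // !sqrf_eq0 eq_complex.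
have nc : {for s, continuous (fun x => (n x)^-1)}.
  apply: continuousV => //.
  rewrite (_ : n = ((fun x => complex.Re (f x)) \* (fun x => complex.Re (f x)))
    + ((fun x => complex.Im (f x)) \* (fun x => complex.Im (f x)))).
    by apply: continuousD; exact: continuousM.
  by apply/funext => x; rewrite /n !expr2.
split.
- rewrite (_ : (fun x => _) = (fun x => complex.Re (f x)) \* (fun x => (n x)^-1)).
    exact: continuousM.
  by apply/funext => x; rewrite /n /=; case: (f x).
- rewrite (_ : (fun x => _) = (fun x => - complex.Im (f x)) \* (fun x => (n x)^-1)).
    by apply: continuousM nc; exact: continuousN.
  by apply/funext => x; rewrite /n /=; case: (f x) => a b /=; rewrite mulNr.
Qed.

Lemma ccontX f n s : ccont f s -> ccont (fun x => f x ^+ n) s.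
Proof.
move=> h; elim: n => [|n ih]; first exact: ccont_cst.
rewrite (_ : (fun x => _) = (fun x => f x * f x ^+ n)); first exact: ccontM.
by apply/funext => x; rewrite exprS.
Qed.

Lemma ccont_Cexp f s : ccont f s -> ccont (fun x => Cexp (f x)) s.
Proof.
move=> [f1 f2].
have he := continuous_comp f1 (@continuous_expR R _).
have hc := continuous_comp f2 (@continuous_cos R _).
have hs := continuous_comp f2 (@continuous_sin R _).
by split; rewrite /Cexp /=; exact: continuousM.
Qed.

Lemma ccont_Cexp_rem n f s : ccont f s -> ccont (fun x => Cexp_rem n (f x)) s.
Proof.
move=> h; rewrite /Cexp_rem; apply: ccontD; first exact: ccont_Cexp.
apply: ccontN; elim: n => [|n ih].
  rewrite (_ : (fun x => _) = (fun=> 0)); first exact: ccont_cst.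
  by apply/funext => x; rewrite big_ord0.
rewrite (_ : (fun x => _) =
  (fun x => \sum_(k < n) f x ^+ k / k`!%:R + f x ^+ n * n`!%:R^-1)).
  apply: ccontD ih _; apply: ccontM; [exact: ccontX | exact: ccont_cst].
by apply/funext => x; rewrite big_ord_recr.
Qed.

Lemma ccont_near f g s : (\forall x \near s, f x = g x) -> ccont f s -> ccont g s.
Proof.
move=> h [f1 f2]; have hs := nbhs_singleton h.
split; rewrite /prop_for /continuous_at -hs; [apply: cvg_trans f1|apply: cvg_trans f2];
  apply: near_eq_cvg; near=> x; congr (_ _); near: x; exact: h.
Unshelve. all: by end_near. Qed.

Lemma ccontP f s : ccont f s <-> forall e : R, 0 < e ->
  exists2 eta : R, 0 < eta & forall x, `|x - s| < eta -> normc (f x - f s) < e.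
Proof.
split.
- move=> [f1 f2] e e0.
  have e20 : 0 < e / 2%:R by rewrite divr_gt0.
  have /cvgrPdist_lt /(_ _ e20) h1 := f1.
  have /cvgrPdist_lt /(_ _ e20) h2 := f2.
  have [eta /= eta0 heta] := filterI h1 h2.
  exists eta => // x hx; have [] := heta x; first by rewrite /ball_ /= distrC.
  move=> k1 k2; apply: le_lt_trans (normc_le_ReIm _) _.
  rewrite Re_sub Im_sub distrC [X in _ + X]distrC.
  by rewrite [e]splitr ltrD.
- move=> h; split; apply/cvgrPdist_lt => e e0; have [eta eta0 heta] := h e e0;
    exists eta => //= x hx; rewrite distrC -?Re_sub -?Im_sub;
    [apply: le_lt_trans (Re_le_normc _) _ | apply: le_lt_trans (Im_le_normc _) _];
    by apply: heta; rewrite distrC.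
Qed.

End ContinuousAt.

(** * Calculus of small Lipschitz families *)

Section SmallLipschitz.
Variables (R : realType) (U : R[i] -> Prop) (B : R).
Hypothesis U_bounded : forall z, U z -> normc z <= B.
Implicit Types f g : R -> R[i] -> R[i].

(* slip = small and Lipschitz: a term of order s^n that survives Newton's iteration. *)
Definition slip n f := exists K s1 : R, [/\ 0 <= K, 0 < s1, s1 <= 1 &
  forall s, 0 < s < s1 -> forall z w, U z -> U w ->
  [/\ normc (f s z) <= K * s ^+ n,
      normc (f s z - f s w) <= K * s ^+ n * normc (z - w) &
      ccont (f^~ z) s]].

Lemma slip_cst (c : R[i]) : slip 0 (fun _ _ => c).
Proof.
exists (normc c), 1; split; rewrite ?normc_ge0 // => s _ z w _ _; split.
- by rewrite expr0 mulr1.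
- by rewrite subrr Normc.normc0 !mulr_ge0 ?normc_ge0.
- exact: ccont_cst.
Qed.

Lemma slip_var : slip 0 (fun _ z => z).
Proof.
exists (Num.max 1 B), 1; split; rewrite ?le_max ?ler01 // => s _ z w hz hw; split.
- by rewrite expr0 mulr1 le_max U_bounded ?orbT.
- by rewrite expr0 mulr1 ler_peMl ?normc_ge0 // le_max lexx.
- exact: ccont_cst.
Qed.

Lemma slip_scale : slip 1 (fun s _ => s%:C).
Proof.
exists 1, 1; split; rewrite ?ler01 ?ltr01 // => s /andP[s0 _] z w _ _; split.
- by rewrite normcR gtr0_norm // mul1r.
- by rewrite subrr Normc.normc0 mul1r mulr_ge0 ?normc_ge0 // expr1 ltW.
- by apply: ccont_real; exact: cvg_id.
Qed.

Lemma slipD n f g : slip n f -> slip n g -> slip n (fun s z => f s z + g s z).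
Proof.
move=> [K [s1 [K0 s10 s11 hf]]] [L [s2 [L0 s20 s21 hg]]].
exists (K + L), (Num.min s1 s2); split.
- exact: addr_ge0.
- by rewrite lt_min s10.
- by rewrite ge_min s11.
move=> s; rewrite lt_min => /and3P[s0 h1 h2] z w hz hw; have s0' := ltW s0.
have [|f1 f2 f3] := hf s _ z w hz hw; first by rewrite s0.
have [|g1 g2 g3] := hg s _ z w hz hw; first by rewrite s0.
split.
- by apply: le_trans (normcD _ _) _; rewrite mulrDl lerD.
- have -> : f s z + g s z - (f s w + g s w) = (f s z - f s w) + (g s z - g s w) by ring.
  by apply: le_trans (normcD _ _) _; rewrite !mulrDl lerD.
- exact: ccontD.
Qed.

Lemma slipM n m f g : slip n f -> slip m g -> slip (n + m) (fun s z => f s z * g s z).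
Proof.
move=> [K [s1 [K0 s10 s11 hf]]] [L [s2 [L0 s20 s21 hg]]].
(* Each of the terms (f z - f w) g w and f z (g z - g w) contributes one [K * L]. *)
exists (2%:R * (K * L)), (Num.min s1 s2); split.
- by rewrite !mulr_ge0.
- by rewrite lt_min s10.
- by rewrite ge_min s11.
move=> s; rewrite lt_min => /and3P[s0 h1 h2] z w hz hw; have s0' := ltW s0.
have [|f1 f2 f3] := hf s _ z w hz hw; first by rewrite s0.
have [|g1 g2 g3] := hg s _ z w hz hw; first by rewrite s0.
have [|g4 _ _] := hg s _ w z hw hz; first by rewrite s0.
have KL0 : 0 <= K * s ^+ n * (L * s ^+ m) by rewrite !mulr_ge0 ?exprn_ge0.
have e : 2%:R * (K * L) * s ^+ (n + m) =
    K * s ^+ n * (L * s ^+ m) + K * s ^+ n * (L * s ^+ m).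
  by rewrite exprD; ring.
split.
- rewrite Normc.normcM e; apply: le_trans (ler_pM (normc_ge0 _) (normc_ge0 _) f1 g1) _.
  by rewrite lerDl.
- have -> : f s z * g s z - f s w * g s w =
      (f s z - f s w) * g s w + f s z * (g s z - g s w) by ring.
  apply: le_trans (normcD _ _) _; rewrite !Normc.normcM e mulrDl lerD //.
  + apply: le_trans (ler_pM (normc_ge0 _) (normc_ge0 _) f2 g4) _.
    by rewrite [leLHS]mulrAC.
  + apply: le_trans (ler_pM (normc_ge0 _) (normc_ge0 _) f1 g2) _.
    by rewrite [leLHS]mulrA.
- exact: ccontM.
Qed.

(** Equality for 0 < s < 1 suffices because the threshold in [slip] is at most 1, and continuity
    transfers because that interval is open. Terms assembled from the rules of this section are
    brought to the desired shape through this lemma. *)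
Lemma slip_ext n f g : slip n f -> (forall s z, 0 < s < 1 -> U z -> f s z = g s z) ->
  slip n g.
Proof.
move=> [K [s1 [K0 s10 s11 hf]]] e; exists K, s1; split=> // s hs z w hz hw.
have [f1 f2 f3] := hf s hs z w hz hw; have /andP[s0 ss1] := hs; have s0' := ltW s0.
have hs1 : 0 < s < 1 by rewrite s0 (lt_le_trans ss1).
split; rewrite -?e //; apply: ccont_near f3.
near=> x; apply: e => //; apply/andP; split; near: x.
- exact: lt_nbhsr.
- by apply: lt_nbhsl; exact: (lt_le_trans ss1).
Unshelve. all: by end_near. Qed.

Lemma slip_le m n f : (m <= n)%N -> slip n f -> slip m f.
Proof.
move=> mn [K [s1 [K0 s10 s11 hf]]]; exists K, s1; split=> // s hs z w hz hw.
have [f1 f2 f3] := hf s hs z w hz hw; have /andP[s0 ss1] := hs; have s0' := ltW s0.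
have hK : K * s ^+ n <= K * s ^+ m.
  by rewrite ler_wpM2l // ler_wiXn2l // ltW //; apply: lt_le_trans ss1 s11.
split=> //; first exact: le_trans f1 hK.
by apply: le_trans f2 _; rewrite ler_wpM2r ?normc_ge0.
Qed.

Lemma slipMl n (c : R[i]) f : slip n f -> slip n (fun s z => c * f s z).
Proof. by move=> h; have := slipM (slip_cst c) h; rewrite add0n. Qed.

Lemma slipN n f : slip n f -> slip n (fun s z => - f s z).
Proof.
by move=> h; apply: slip_ext (slipMl (-1) h) _ => s z _ _; rewrite mulN1r.
Qed.

Lemma slipB n f g : slip n f -> slip n g -> slip n (fun s z => f s z - g s z).
Proof. by move=> hf hg; exact: slipD hf (slipN hg). Qed.

Lemma slipX k n f : slip n f -> slip (n * k) (fun s z => f s z ^+ k).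
Proof.
move=> h; elim: k => [|k ih]; first by rewrite muln0; exact: slip_cst.
rewrite mulnS; apply: slip_ext (slipM h ih) _ => s z _ _; by rewrite exprS.
Qed.

Lemma slip_div_scale m n f : slip (n + m) f -> slip n (fun s z => f s z / s%:C ^+ m).
Proof.
move=> [K [s1 [K0 s10 s11 hf]]]; exists K, s1; split=> // s hs z w hz hw.
have [f1 f2 f3] := hf s hs z w hz hw; have /andP[s0 ss1] := hs; have s0' := ltW s0.
have ns : normc ((s%:C ^+ m)^-1) = (s ^+ m)^-1.
  by rewrite Normc.normcV normcX normcR gtr0_norm.
have e (a : R) : a * s ^+ (n + m) / s ^+ m = a * s ^+ n.
  by rewrite exprD mulrA mulfK // expf_neq0 // gt_eqF.
have si : 0 <= (s ^+ m)^-1 by rewrite invr_ge0 exprn_ge0 // ltW.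
split.
- by rewrite Normc.normcM ns -e ler_wpM2r.
- by rewrite -mulrBl Normc.normcM ns -e mulrAC ler_wpM2r.
- apply: ccontM => //; apply: ccontV.
    by rewrite expf_neq0 // (inj_eq (@complexI _)) gt_eqF.
  by apply: ccontX; apply: ccont_real; exact: cvg_id.
Qed.

(** From 1/f(z) - 1/f(w) = -(f(z) - f(w)) / (f(z) f(w)): the Lipschitz constant picks up K / mu^2,
    while 1 / mu bounds the values. *)
Lemma slipV (mu s2 : R) f : 0 < mu -> 0 < s2 ->
  (forall s z, 0 < s < s2 -> U z -> mu <= normc (f s z)) -> slip 0 f ->
  slip 0 (fun s z => (f s z)^-1).
Proof.
move=> m0 s20 hm [K [s1 [K0 s10 s11 hf]]].
have m0' := ltW m0; exists (mu^-1 + K / mu ^+ 2), (Num.min s1 s2); split.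
- by rewrite addr_ge0 ?mulr_ge0 ?invr_ge0 ?exprn_ge0.
- by rewrite lt_min s10.
- by rewrite ge_min s11.
move=> s; rewrite lt_min => /and3P[s0 h1 h2] z w hz hw; have s0' := ltW s0.
have [|f1 f2 f3] := hf s _ z w hz hw; first by rewrite s0.
have hs2 : 0 < s < s2 by rewrite s0.
have mz := hm s z hs2 hz; have mw := hm s w hs2 hw.
have nz u : mu <= normc u -> u != 0.
  by move=> h; apply/eqP => u0; move: h; rewrite u0 Normc.normc0 leNgt m0.
have iz u : mu <= normc u -> normc u^-1 <= mu^-1.
  by move=> h; rewrite Normc.normcV lef_pV2 ?posrE //; exact: lt_le_trans h.
rewrite !expr0 !mulr1 in f1 f2 *; split.
- apply: le_trans (iz _ mz) _.
  by rewrite lerDl mulr_ge0 ?invr_ge0 ?exprn_ge0.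
- have -> : (f s z)^-1 - (f s w)^-1 = - ((f s z)^-1 * (f s w)^-1 * (f s z - f s w)).
    by field; rewrite nz //= nz.
  rewrite normcN !Normc.normcM.
  have h3 : normc (f s z)^-1 * normc (f s w)^-1 <= mu^-1 * mu^-1.
    by rewrite ler_pM ?normc_ge0 ?iz.
  apply: le_trans (ler_pM _ _ h3 f2) _; rewrite ?mulr_ge0 ?normc_ge0 //.
  rewrite mulrA ler_wpM2r ?normc_ge0 // expr2 invfM [_ * K]mulrC lerDr.
  by rewrite invr_ge0 ltW.
- by apply: ccontV f3; exact: nz.
Qed.

Lemma slip_Cexp_rem n (a : R[i]) :
  slip n.+1 (fun s z => Cexp_rem n.+1 (s%:C * a * z)).
Proof.
have [K K0 hK] := @Cexp_rem_lipschitz R n.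
(* [A] bounds |a z| on [U], with 1 added for positivity; the threshold 1 / A keeps s a z in the unit
   disc, where the remainder estimate holds. *)
pose A := normc a * Num.max 0 B + 1.
have B0 : 0 <= Num.max 0 B by rewrite le_max lexx.
have A0 : 0 < A by apply: ltr_wpDl; [exact: mulr_ge0 (normc_ge0 _) B0 | exact: ltr01].
have A1 : normc a * Num.max 0 B <= A by rewrite /A lerDl.
exists (K * A ^+ n * (A + normc a)), (Num.min 1 A^-1); split.
- have A0' := ltW A0; exact: mulr_ge0 (mulr_ge0 K0 (exprn_ge0 _ A0')) (addr_ge0 A0' (normc_ge0 _)).
- by rewrite lt_min ltr01 invr_gt0.
- by rewrite ge_min lexx.
move=> s; rewrite lt_min => /and3P[s0 s1 sA] z w hz hw; have s0' := ltW s0; have A0' := ltW A0.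
have hr u : U u -> normc (s%:C * a * u) <= s * A.
  move=> hu; rewrite !Normc.normcM normcR gtr0_norm // -mulrA ler_wpM2l //.
  apply: le_trans A1; rewrite ler_wpM2l ?normc_ge0 // le_max U_bounded ?orbT //.
have r1 : s * A <= 1.
  by rewrite -ler_pdivlMr // div1r ltW.
have hK' u v : normc u <= s * A -> normc v <= s * A ->
  normc (Cexp_rem n.+1 u - Cexp_rem n.+1 v) <= K * (s * A) ^+ n * normc (u - v).
  exact: hK.
have sA0 : 0 <= s * A by rewrite mulr_ge0.
have KA : 0 <= K * (s * A) ^+ n by rewrite mulr_ge0 ?exprn_ge0.
split.
- have := hK' _ 0 (hr _ hz); rewrite Normc.normc0 => /(_ sA0).
  rewrite Cexp_rem0 !subr0 => /le_trans; apply.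
  apply: le_trans (ler_wpM2l KA (hr _ hz)) _.
  rewrite exprMn exprSr.
  have -> : K * (s ^+ n * A ^+ n) * (s * A) = K * A ^+ n * A * (s ^+ n * s) by ring.
  rewrite ler_wpM2r ?mulr_ge0 ?exprn_ge0 // ler_wpM2l ?mulr_ge0 ?exprn_ge0 //.
  by rewrite lerDl normc_ge0.
- apply: le_trans (hK' _ _ (hr _ hz) (hr _ hw)) _.
  rewrite -mulrBr !Normc.normcM normcR gtr0_norm // exprMn exprSr mulrA.
  rewrite ler_wpM2r ?normc_ge0 //.
  have -> : K * (s ^+ n * A ^+ n) * (s * normc a) = K * A ^+ n * normc a * (s ^+ n * s) by ring.
  rewrite ler_wpM2r ?mulr_ge0 ?exprn_ge0 // ler_wpM2l ?mulr_ge0 ?exprn_ge0 //.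
  by rewrite lerDr ltW.
- apply: ccont_Cexp_rem; apply: ccontM; last exact: ccont_cst.
  apply: ccontM; last exact: ccont_cst.
  by apply: ccont_real; exact: cvg_id.
Qed.

Lemma slip_linear (a : R[i]) : slip 1 (fun s z => s%:C * a * z).
Proof. by have := slipM (slipM slip_scale (slip_cst a)) slip_var; rewrite !addn0. Qed.

(** The exponentials of i t and -i t are expanded through degree 4. Their difference keeps only odd
    powers, so the error after t - t^3 / 6 already has order 5. *)
Lemma slip_Csin (a : R) :
  slip 5 (fun s z => Csin (s%:C * a%:C * z) - s%:C * a%:C * z
                     + (s%:C * a%:C * z) ^+ 3 / 6%:R).
Proof.
apply: slip_ext (slipMl (2%:R * 'i)^-1
  (slipB (slip_Cexp_rem 4 ('i * a%:C)) (slip_Cexp_rem 4 (- 'i * a%:C)))) _ => s z _ _.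
set t := s%:C * a%:C * z.
have -> : s%:C * ('i * a%:C) * z = 'i * t by rewrite /t; ring.
have -> : s%:C * (- 'i * a%:C) * z = - ('i * t) by rewrite /t; ring.
have i2 : 'i%R * 'i%R = -1 :> R[i] by rewrite -expr2 sqr_i.
have i0 : 'i%R != 0 :> R[i] by exact: neq0Ci.
have iV : 'i%R^-1 = - 'i%R :> R[i] by apply: (mulfI i0); rewrite divff // mulrN i2 opprK.
have p3 x : ('i * x) ^+ 3 = - 'i * x ^+ 3 :> R[i].
  by rewrite exprS exprMn sqr_i; ring.
have p2 x : ('i * x) ^+ 2 = - x ^+ 2 :> R[i] by rewrite exprMn sqr_i mulN1r.
have p4 x : ('i * x) ^+ 4 = x ^+ 4 :> R[i].
  by rewrite -[4%N]/(2 + 2)%N exprD p2 mulrNN -exprD.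
rewrite /Csin /Cexp_rem !big_ord_recr !big_ord0 /= -mulrN !p2 !p3 !p4 !expr0 !expr1.
rewrite invfM iV (_ : 0`! = 1)%N // (_ : 1`! = 1)%N // (_ : 2`! = 2)%N //
  (_ : 3`! = 6)%N // (_ : 4`! = 24)%N //.
set E1 := Cexp _; set E2 := Cexp _; set I := 'i%R in i2 *.
have -> : (2%:R^-1 : R[i]) * - I * (E1 - (0 + 1 / 1%:R + I * t / 1%:R + - t ^+ 2 / 2%:R
     + - I * t ^+ 3 / 6%:R + t ^+ 4 / 24%:R) -
   (E2 - (0 + 1 / 1%:R + I * - t / 1%:R + - (- t) ^+ 2 / 2%:R
     + - I * (- t) ^+ 3 / 6%:R + (- t) ^+ 4 / 24%:R))) =
  (E1 - E2) * (2%:R^-1 * - I) + (I * I) * (t - t ^+ 3 / 6%:R) by field.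
by rewrite i2 mulN1r opprB [_ - t]addrC addrA.
Qed.

(** As for the sine: the sum of two expansions through degree 3 keeps only even powers. *)
Lemma slip_Ccos (a : R) :
  slip 4 (fun s z => Ccos (s%:C * a%:C * z) - 1 + (s%:C * a%:C * z) ^+ 2 / 2%:R).
Proof.
apply: slip_ext (slipMl 2%:R^-1
  (slipD (slip_Cexp_rem 3 ('i * a%:C)) (slip_Cexp_rem 3 (- 'i * a%:C)))) _ => s z _ _.
set t := s%:C * a%:C * z.
have -> : s%:C * ('i * a%:C) * z = 'i * t by rewrite /t; ring.
have -> : s%:C * (- 'i * a%:C) * z = - ('i * t) by rewrite /t; ring.
have p2 x : ('i * x) ^+ 2 = - x ^+ 2 :> R[i] by rewrite exprMn sqr_i mulN1r.
have p3 x : ('i * x) ^+ 3 = - 'i * x ^+ 3 :> R[i].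
  by rewrite exprS p2; ring.
rewrite /Ccos /Cexp_rem !big_ord_recr !big_ord0 /= -mulrN !p2 !p3 !expr0 !expr1.
rewrite (_ : 0`! = 1)%N // (_ : 1`! = 1)%N // (_ : 2`! = 2)%N // (_ : 3`! = 6)%N //.
set E1 := Cexp _; set E2 := Cexp _; set I := 'i%R.
by field.
Qed.

End SmallLipschitz.

(** * The root of z^2 = c^2 + G(s, z) near c *)

Section PerturbedRoot.
Variables (R : realType) (c b : R) (G : R -> R[i] -> R[i]).
Hypothesis c0 : 0 < c.
Let U (z : R[i]) := normc (z - c%:C) <= c / 4%:R.
Hypothesis G_slip : slip U 2 (fun s z => G s z + 'i * b%:C * s%:C * z).

Lemma near_center_bounded z : U z -> normc z <= 2%:R * c.
Proof.
move=> hz; have := normcD (z - c%:C) c%:C; rewrite subrK normcR gtr0_norm // => h.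
by move: c0 h hz; rewrite /U; normc_lra.
Qed.

Let G_slip1 : slip U 1 G.
Proof.
have h : slip U 1 (fun s z => 'i * b%:C * s%:C * z).
  have := slipM (slipMl ('i * b%:C) (slip_scale U)) (slip_var near_center_bounded).
  by rewrite addn0.
apply: slip_ext (slipB (slip_le (leqnSn 1) G_slip) h) _ => s z _ _.
by rewrite addrK.
Qed.

Let Phi s z := z - (z ^+ 2 - c%:C ^+ 2 - G s z) / (2%:R * c)%:C.

Let Phi_contracts K s z w : K * s <= c / 2%:R -> U z -> U w ->
  normc (G s z - G s w) <= K * s * normc (z - w) ->
  normc (Phi s z - Phi s w) <= normc (z - w) / 2%:R.
Proof.
move=> hK hz hw hG.
have C0 : c%:C != 0 :> R[i] by rewrite (inj_eq (@complexI _)) gt_eqF.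
have e : Phi s z - Phi s w =
    ((z - w) * ((c%:C - z) + (c%:C - w)) + (G s z - G s w)) / (2%:R * c)%:C.
  by rewrite /Phi rmorphM rmorph_nat; field.
rewrite e Normc.normcM Normc.normcV normcR gtr0_norm ?mulr_gt0 //.
rewrite ler_pdivrMr ?mulr_gt0 //.
apply: le_trans (normcD _ _) _; rewrite Normc.normcM.
have h1 : normc ((c%:C - z) + (c%:C - w)) <= c / 2%:R.
  apply: le_trans (normcD _ _) _; rewrite normc_distC [X in _ + X]normc_distC.
  by move: c0 hz hw; rewrite /U; normc_lra.
have N0 := normc_ge0 (z - w).
have h2 := ler_wpM2l N0 h1.
have h3 := ler_wpM2r N0 hK.
move: h2 h3 hG; rewrite -/(normc _).
set a := normc (z - w); set b1 := normc (_ + _); set b2 := normc (_ - _).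
move: a b1 b2 => a b1 b2; lra.
Qed.

Lemma perturbed_root : exists s1 K : R, exists Z : R -> R[i], 0 < s1 /\
  forall s, 0 < s < s1 ->
  [/\ U (Z s), Z s ^+ 2 = c%:C ^+ 2 + G s (Z s),
      normc (Z s - (c%:C - 'i * (b / 2%:R * s)%:C)) <= K * s ^+ 2 & ccont Z s].
Proof.
have [K [s0 [K0 s00 s01 hG]]] := G_slip1.
have [L [s0' [L0 s00' s01' hG2]]] := G_slip.
(* K s <= c / 2 gives the contraction; K s <= c^2 / 4 keeps the image of the disc inside the
   disc. *)
pose m := Num.min (c / 2%:R) (c ^+ 2 / 4%:R).
have m0 : 0 < m by rewrite lt_min !divr_gt0 // exprn_gt0.
have K1 : 0 < K + 1 by rewrite ltr_wpDl.
pose s1 := Num.min (Num.min s0 s0') (m / (K + 1)).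
have s10 : 0 < s1 by rewrite !lt_min s00 s00' divr_gt0.
have C0 : c%:C != 0 :> R[i] by rewrite (inj_eq (@complexI _)) gt_eqF.
have hs s : 0 < s < s1 ->
    [/\ 0 < s < s0, 0 < s < s0', K * s <= c / 2%:R & K * s <= c ^+ 2 / 4%:R].
  move=> /andP[sp]; rewrite !lt_min => /andP[/andP[h1 h2] h3]; rewrite sp h1 h2.
  have : K * s <= m.
    rewrite ltr_pdivlMr // in h3; apply: le_trans (ltW h3).
    by rewrite mulrC ler_wpM2l ?ltW // ltrDl.
  by rewrite le_min => /andP[].
have Uc : U c%:C by rewrite /U subrr Normc.normc0 divr_ge0 // ltW.
have hctr s z w : 0 < s < s1 -> U z -> U w ->
    normc (Phi s z - Phi s w) <= normc (z - w) / 2%:R.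
  move=> /hs[h1 _ h2 _] hz hw; apply: (Phi_contracts h2 hz hw).
  by have [_ + _] := hG s h1 z w hz hw; rewrite expr1.
have hcen s : 0 < s < s1 -> normc (Phi s c%:C - c%:C) <= K * s / (2%:R * c).
  move=> /hs[h1 _ _ _].
  have -> : Phi s c%:C - c%:C = G s c%:C / (2%:R * c)%:C.
    by rewrite /Phi rmorphM rmorph_nat; field.
  rewrite Normc.normcM Normc.normcV normcR gtr0_norm ?mulr_gt0 //.
  rewrite ler_pM2r ?invr_gt0 ?mulr_gt0 //.
  by have [+ _ _] := hG s h1 c%:C c%:C Uc Uc; rewrite expr1.
(* Outside the range of [s] the dummy value 0 is taken, so that [choice] yields a total function. *)
have hex s : exists z, 0 < s < s1 -> U z /\ Phi s z = z.
  case: (boolP (0 < s < s1)) => hss; last by exists 0.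
  have [|||z hz hF] := @contraction_fixed_point R (Phi s) c%:C (c / 4%:R).
  - move=> z hz; apply: le_trans (normc_distD (Phi s c%:C) _ _) _.
    have h1 := hctr s z c%:C hss hz Uc; have h2 := hcen s hss.
    (* The centre moves by at most c / 8, and contraction halves the radius c / 4; the two add up to
       c / 4. *)
    have h3 : K * s / (2%:R * c) <= c / 8%:R.
      rewrite ler_pdivrMr ?mulr_gt0 //.
      by have [_ _ _] := hs s hss; lra.
    by move: h1 h2 h3 hz; rewrite /U; normc_lra.
  - by move=> z w; exact: hctr.
  - by rewrite divr_ge0 // ltW.
  - by exists z.
have [Z hZ] := choice hex.
exists s1, (`|b| * K / (2%:R * c ^+ 2) + L / c), Z; split=> // s hss.
have [UZ FZ] := hZ s hss.
have eqZ : Z s ^+ 2 = c%:C ^+ 2 + G s (Z s).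
  have e : Z s ^+ 2 - c%:C ^+ 2 - G s (Z s) = (Z s - Phi s (Z s)) * (2%:R * c%:C).
    by rewrite /Phi rmorphM rmorph_nat; field.
  by rewrite FZ subrr mul0r -addrA -opprD in e; apply/eqP; rewrite -subr_eq0 e.
have [h1 h1' _ _] := hs s hss; have /andP[sp _] := hss.
split=> //.
- have hZc : normc (Z s - c%:C) <= K * s / c.
    have h2 := hctr s _ _ hss UZ Uc; have h3 := hcen s hss.
    have := normc_distD (Phi s c%:C) (Z s) c%:C; rewrite -{2}FZ => h4.
    have e : K * s / c = 2%:R * (K * s / (2%:R * c)) by field; rewrite gt_eqF.
    by rewrite e; move: h2 h3 h4; normc_lra.
  set E := G s (Z s) + 'i * b%:C * s%:C * Z s.
  have hE : normc E <= L * s ^+ 2 by have [] := hG2 s h1' (Z s) (Z s) UZ UZ.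
  have hd : c <= normc (Z s + c%:C).
    have := normcD (Z s + c%:C) (c%:C - Z s).
    have -> : Z s + c%:C + (c%:C - Z s) = (2%:R * c)%:C by rewrite rmorphM rmorph_nat; ring.
    rewrite normcR gtr0_norm ?mulr_gt0 // normc_distC; move: c0 UZ; rewrite /U; normc_lra.
  have Zc0 : Z s + c%:C != 0.
    by apply/eqP => h; move: hd; rewrite h Normc.normc0 leNgt c0.
  (* The product is Z^2 - c^2 + i b s (Z + c) / 2; inserting the equation for Z leaves [E] and a
     multiple of s (Z - c), both O(s^2). *)
  have e : (Z s - (c%:C - 'i * (b / 2%:R * s)%:C)) * (Z s + c%:C) =
      E - 'i * (b / 2%:R * s)%:C * (Z s - c%:C).
    have -> : 'i * (b / 2%:R * s)%:C = 'i * b%:C * s%:C / 2%:R :> R[i].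
      by rewrite !rmorphM fmorphV rmorph_nat; ring.
    rewrite /E; set I := 'i * _ * _.
    have -> : G s (Z s) = Z s ^+ 2 - c%:C ^+ 2 by rewrite eqZ addrC addKr.
    by field.
  have h5 : normc (Z s - (c%:C - 'i * (b / 2%:R * s)%:C)) * c <=
      L * s ^+ 2 + `|b| / 2%:R * s * (K * s / c).
    apply: le_trans (ler_wpM2l (normc_ge0 _) hd) _.
    rewrite -Normc.normcM e; apply: le_trans (normcD _ _) _.
    rewrite normcN !Normc.normcM normci mul1r normcR; apply: lerD => //.
    rewrite !normrM (gtr0_norm sp) (@ger0_norm _ 2%:R^-1) ?invr_ge0 //.
    by rewrite ler_wpM2l // !mulr_ge0 ?invr_ge0 // ltW.
  rewrite -ler_pdivlMr // in h5; apply: le_trans h5 _.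
  by rewrite le_eqVlt; apply/orP; left; apply/eqP; field; rewrite gt_eqF.
- apply/ccontP => e e0.
  have [_ _ /ccontP hGc] := hG s h1 (Z s) (Z s) UZ UZ.
  have [|eta eta0 heta] := hGc (e * c); first by rewrite mulr_gt0.
  have /andP[_ ss1] := hss.
  exists (Num.min eta (Num.min s (s1 - s))); first by rewrite !lt_min eta0 sp subr_gt0.
  move=> x; rewrite !lt_min => /and3P[x1 x2 x3].
  have hx : 0 < x < s1.
    by move: x2 x3; rewrite !ltr_norml => /andP[? ?] /andP[? ?]; apply/andP; split; lra.
  have [Ux Fx] := hZ x hx.
  have h2 := hctr x _ _ hx Ux UZ.
  have h3 := heta x x1.
  have : normc (Z x - Z s) <=
      normc (Phi x (Z x) - Phi x (Z s)) + normc (Phi x (Z s) - Phi s (Z s)).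
    by rewrite Fx FZ; exact: normc_distD.
  have -> : Phi x (Z s) - Phi s (Z s) = (G x (Z s) - G s (Z s)) / (2%:R * c)%:C.
    by rewrite /Phi rmorphM rmorph_nat; field.
  rewrite [normc (_ / _)]Normc.normcM Normc.normcV normcR gtr0_norm ?mulr_gt0 // => h4.
  have h5 : normc (G x (Z s) - G s (Z s)) / (2%:R * c) < e / 2%:R.
    by rewrite ltr_pdivrMr ?mulr_gt0 //; move: h3; normc_lra.
  by move: h2 h4 h5; normc_lra.
Qed.

End PerturbedRoot.

(** * Determinants of the one- and two-layer transmission matrices *)

Section Determinants.

(** Laplace expansion along the first two rows: column 3 vanishes there and column 0 vanishes in the
    other two rows, so only the column pairs {0,1} and {0,2} contribute. *)
Lemma det_block_tridiagonal4 (F : comNzRingType) (f : nat -> nat -> F) :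
  f 0%N 3%N = 0 -> f 1%N 3%N = 0 -> f 2%N 0%N = 0 -> f 3%N 0%N = 0 ->
  \det (\matrix_(a < 4, b < 4) f a b) =
    (f 0%N 0%N * f 1%N 1%N - f 1%N 0%N * f 0%N 1%N)
      * (f 2%N 2%N * f 3%N 3%N - f 2%N 3%N * f 3%N 2%N)
    - (f 0%N 0%N * f 1%N 2%N - f 1%N 0%N * f 0%N 2%N)
      * (f 2%N 1%N * f 3%N 3%N - f 2%N 3%N * f 3%N 1%N).
Proof.
move=> h03 h13 h20 h30.
do 3 (rewrite !(expand_det_row _ ord0) !big_ord_recl !big_ord0 /cofactor).
rewrite !det_mx11 !mxE /= /bump /= h03 h13 h20 h30.
ring.
Qed.

Lemma det_matrix2 (F : comNzRingType) (f : nat -> nat -> F) :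
  \det (\matrix_(a < 2, b < 2) f a b) = f 0%N 0%N * f 1%N 1%N - f 0%N 1%N * f 1 0.
Proof.
rewrite (expand_det_row _ ord0) !big_ord_recl !big_ord0 /cofactor !det_mx11 !mxE /= /bump /=.
ring.
Qed.

Variable R : realType.
Implicit Types x y z : R[i].

Lemma Cexp_i z : Cexp ('i * z) = Ccos z + 'i * Csin z.
Proof.
rewrite /Ccos /Csin; set E1 := Cexp ('i * z); set E2 := Cexp _.
have i0 : 'i%R != 0 :> R[i] by exact: neq0Ci.
by by field.
Qed.

Lemma CexpN_i z : Cexp (- ('i * z)) = Ccos z - 'i * Csin z.
Proof.
rewrite /Ccos /Csin; set E1 := Cexp ('i * z); set E2 := Cexp _.
have i0 : 'i%R != 0 :> R[i] by exact: neq0Ci.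
by by field.
Qed.

Lemma CsinB x y : Csin (x - y) = Csin x * Ccos y - Ccos x * Csin y.
Proof.
have i2 : 'i%R ^+ 2 = -1 :> R[i] by exact: sqrCi.
have i0 : 'i%R != 0 :> R[i] by exact: neq0Ci.
rewrite {1}/Csin mulrBr opprB [_ - 'i%R * x]addrC !CexpD.
rewrite !CexpN_i !Cexp_i.
by field.
Qed.

Lemma CcosB x y : Ccos (x - y) = Ccos x * Ccos y + Csin x * Csin y.
Proof.
have i2 : 'i%R ^+ 2 = -1 :> R[i] by exact: sqrCi.
rewrite {1}/Ccos mulrBr opprB [_ - 'i%R * x]addrC !CexpD.
rewrite !CexpN_i !Cexp_i.
set a := Ccos x; set b := Csin x; set c := Ccos y; set d := Csin y.
have -> : (a + 'i * b) * (c - 'i * d) + (a - 'i * b) * (c + 'i * d) =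
  2%:R * (a * c - 'i%R ^+ 2 * (b * d)) by ring.
by rewrite i2; field.
Qed.

(** The splitting h_0 = j_0 + i y_0, with y_0(z) = - cos z / z. *)
Lemma sh_sj z : sh z = sj z - 'i * (Ccos z / z).
Proof.
have i2 : 'i%R ^+ 2 = -1 :> R[i] by exact: sqrCi.
rewrite /sh /sj Cexp_i.
have -> : - 'i%R * (Ccos z + 'i * Csin z) / z =
  (- 'i%R ^+ 2 * Csin z - 'i * Ccos z) / z by ring.
by rewrite i2; ring.
Qed.

Lemma sh'_sj' z : sh' z = sj' z + 'i * (Csin z / z + Ccos z / z ^+ 2).
Proof.
have i2 : 'i%R ^+ 2 = -1 :> R[i] by exact: sqrCi.
rewrite /sh' /sj' Cexp_i.
have -> : (Ccos z + 'i%R * Csin z) / z + 'i * (Ccos z + 'i%R * Csin z) / z ^+ 2 =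
  Ccos z / z + 'i%R ^+ 2 * Csin z / z ^+ 2 + 'i * (Csin z / z + Ccos z / z ^+ 2) by ring.
by rewrite i2; ring.
Qed.

(* To be used with y_i = k_r r_i, x1 = k r_1 and beta = x_2 cot x_2 - 1. *)
Definition reduced_det (y1 y2 x1 beta dl : R[i]) :=
  let A := 1 - dl * (1 - 'i * x1) in let B := 1 + dl * beta in
  (y1 * y2 + A * B) * Csin (y1 - y2) - (B * y1 - A * y2) * Ccos (y1 - y2).

Variables (vr v : R).
Hypotheses (vr0 : 0 < vr) (v0 : 0 < v).

Lemma real_complex_neq0 (a : R) : 0 < a -> a%:C != 0 :> R[i].
Proof. by move=> a0; rewrite (inj_eq (@complexI R)) gt_eqF. Qed.

(** The first column carries exp(i x), and h'(x) / h(x) = -(1 - i x) / x is the source of the factor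
    A; what remains after clearing denominators is A sin y - y cos y. *)
Lemma det_transA1 (r : nat -> R) (d : R) (w : R[i]) : 0 < r 1%N -> w != 0 ->
  reduced_det (w / vr%:C * (r 1%N)%:C) 0 (w / v%:C * (r 1%N)%:C) 0 d%:C = 0 ->
  \det (transA vr v r d w 1) = 0.
Proof.
move=> r10 w0; rewrite /transA (det_matrix2 (fun a b => if (b %/ 2).+1 == (a %/ 2).+1 then
  Mblk vr v r d w (a %/ 2).+1 (odd a) (odd b) else if (b %/ 2).+1 == (a %/ 2).+2 then
  Rblk vr v r d w (a %/ 2).+1 (odd a) (odd b) else if (a %/ 2).+1 == (b %/ 2).+2 then
  Lblk vr v r d w (a %/ 2).+1 (odd a) (odd b) else 0)) /= /Mblk /e2 /=.
set x := w / v%:C * _; set y := w / vr%:C * _.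
have x0 : x != 0 :=
  mulf_neq0 (mulf_neq0 w0 (invr_neq0 (real_complex_neq0 v0))) (real_complex_neq0 r10).
have y0 : y != 0 :=
  mulf_neq0 (mulf_neq0 w0 (invr_neq0 (real_complex_neq0 vr0))) (real_complex_neq0 r10).
have -> : (v / vr)%:C = y / x.
  rewrite /x /y rmorphM fmorphV; field.
  by rewrite w0 !real_complex_neq0.
rewrite /reduced_det !(subr0, mulr0, add0r, addr0, mul1r, mulr1) => h.
have i2 : 'i%R * 'i%R = -1 :> R[i] by rewrite -expr2 sqrCi.
have hx : x + 'i%R = 'i * (1 - 'i * x) by rewrite mulrBr mulr1 mulrA i2; ring.
have hsh : sh x = - 'i * Cexp ('i * x) / x by [].
have hsh' : sh' x = Cexp ('i * x) * (x + 'i) / x ^+ 2 by rewrite /sh'; field.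
rewrite hsh hsh' hx /sj /sj'; move: h.
set s := Csin y; set c := Ccos y; set E := Cexp _; set I := 'i%R => h.
transitivity (- I * E / (x ^+ 2 * y) * ((1 - d%:C * (1 - I * x)) * s - y * c)); last first.
  by rewrite h mulr0.
by field; rewrite x0 y0.
Qed.

(** The equation for [beta] says beta j(x2) = x2 j'(x2). Both entries of the inner ball are then
    multiples of sin x2, which factors out of the determinant. *)
Lemma det_transA2 (r : nat -> R) (d : R) (w beta : R[i]) : 0 < r 1%N -> 0 < r 2%N -> w != 0 ->
  let x2 := w / v%:C * (r 2%N)%:C in
  beta * Csin x2 = x2 * Ccos x2 - Csin x2 ->
  reduced_det (w / vr%:C * (r 1%N)%:C) (w / vr%:C * (r 2%N)%:C) (w / v%:C * (r 1%N)%:C)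
    beta d%:C = 0 ->
  \det (transA vr v r d w 2) = 0.
Proof.
move=> r10 r20 w0 x2 hb; rewrite /transA (det_block_tridiagonal4
  (f := fun a b => if (b %/ 2).+1 == (a %/ 2).+1 then
  Mblk vr v r d w (a %/ 2).+1 (odd a) (odd b) else if (b %/ 2).+1 == (a %/ 2).+2 then
  Rblk vr v r d w (a %/ 2).+1 (odd a) (odd b) else if (a %/ 2).+1 == (b %/ 2).+2 then
  Lblk vr v r d w (a %/ 2).+1 (odd a) (odd b) else 0)) //= /Mblk /Rblk /Lblk /e2 /=.
rewrite -/x2.
set x := w / v%:C * _; set y := w / vr%:C * (r 1%N)%:C; set y2 := w / vr%:C * _.
have x0 : x != 0 :=
  mulf_neq0 (mulf_neq0 w0 (invr_neq0 (real_complex_neq0 v0))) (real_complex_neq0 r10).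
have y0 : y != 0 :=
  mulf_neq0 (mulf_neq0 w0 (invr_neq0 (real_complex_neq0 vr0))) (real_complex_neq0 r10).
have x20 : x2 != 0 :=
  mulf_neq0 (mulf_neq0 w0 (invr_neq0 (real_complex_neq0 v0))) (real_complex_neq0 r20).
have y20 : y2 != 0 :=
  mulf_neq0 (mulf_neq0 w0 (invr_neq0 (real_complex_neq0 vr0))) (real_complex_neq0 r20).
set tau := (v / vr)%:C.
(* With y_i = tau x_i, only x, x2 and tau remain as independent variables for [field]. *)
have ey : y = tau * x.
  rewrite /x /y /tau rmorphM fmorphV; field.
  by rewrite !real_complex_neq0.
have ey2 : y2 = tau * x2.
  rewrite /x2 /y2 /tau rmorphM fmorphV; field.
  by rewrite !real_complex_neq0.
have t0 : tau != 0.
  by move: y0; rewrite ey; apply: contraNneq => ->; rewrite mul0r.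
rewrite /reduced_det CsinB CcosB => h.
have i2 : 'i%R * 'i%R = -1 :> R[i] by rewrite -expr2 sqrCi.
have hx : x + 'i%R = 'i * (1 - 'i * x) by rewrite mulrBr mulr1 mulrA i2; ring.
have hsh : sh x = - 'i * Cexp ('i * x) / x by [].
have hsh' : sh' x = Cexp ('i * x) * (x + 'i) / x ^+ 2 by rewrite /sh'; field.
have hj2 : sj' x2 = beta * Csin x2 / x2 ^+ 2 by rewrite hb /sj'; field.
rewrite hsh hsh' hx hj2 !sh_sj !sh'_sj' /sj /sj'; move: h; rewrite ey ey2.
set s1 := Csin _; set c1 := Ccos _; set s2 := Csin _; set c2 := Ccos _.
set E := Cexp _; set I := 'i%R; set sx := Csin x2; set dl := d%:C => h.
set D := (X in X = 0) in h.
transitivity (I * E / (x ^+ 2 * (tau * x)) * (sx / (tau * x2 * x2 ^+ 2)) * (- I) * D); last first.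
  by rewrite h mulr0.
by rewrite /D; field; rewrite x0 x20 !real_complex_neq0.
Qed.

End Determinants.

(** * Expansion of the reduced determinant in s *)

Section Asymptotics.
Variables (R : realType) (c : R).
Hypothesis c0 : 0 < c.
Let U (z : R[i]) := normc (z - c%:C) <= c / 4%:R.
Let hU := near_center_bounded c0.

Lemma near_center_ge z : U z -> c / 2%:R <= normc z.
Proof.
move=> hz; have := normcD z (c%:C - z).
rewrite addrC subrK normcR gtr0_norm // normc_distC.
by move: c0 hz; rewrite /U; normc_lra.
Qed.

Lemma near_center_neq0 z : U z -> z != 0.
Proof.
move=> hz; apply/eqP => z0; have := near_center_ge hz.
by rewrite z0 Normc.normc0 leNgt divr_gt0.
Qed.

Lemma slip_near_center_inv : slip U 0 (fun _ z => z^-1).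
Proof.
apply: (@slipV _ _ (c / 2%:R) 1) (slip_var hU) => // [|s z _ hz].
  by rewrite divr_gt0.
exact: near_center_ge.
Qed.

Section InnerLayer.
Variable a : R.
Hypothesis a0 : 0 < a.

Let x (s : R) (z : R[i]) := s%:C * a%:C * z.

(** This is x j_0'(x) / j_0(x), the scaled logarithmic derivative of the regular wave in the inner
    ball. *)
Definition xcot_sub1 s z := (x s z * Ccos (x s z) - Csin (x s z)) / Csin (x s z).

Let q_err : slip U 2 (fun s z => Csin (x s z) / s%:C ^+ 1 - a%:C * z).
Proof.
have h1 := slip_Csin hU a.
have h3 := slipMl 6%:R^-1 (slipX 3 (slip_linear hU a%:C)).
have h : slip U (2 + 1) (fun s z => Csin (x s z) - x s z).
  apply: slip_ext (slipB (slip_le (_ : (3 <= 5)%N) h1) h3) _ => // s z _ _.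
  by rewrite /x; field.
apply: slip_ext (slip_div_scale h) _ => s z /andP[s0 _] _.
by rewrite /x expr1; field; rewrite real_complex_neq0.
Qed.

(** The quotient is a z + O(s^2) with |a z| >= a c / 2; the threshold makes the error at most a c /
    4. *)
Let q_ge : exists2 s2 : R, 0 < s2 & forall s z, 0 < s < s2 -> U z ->
  a * c / 4%:R <= normc (Csin (x s z) / s%:C ^+ 1).
Proof.
have [K [s1 [K0 s10 s11 hK]]] := q_err.
have K1 : 0 < K + 1 by rewrite ltr_wpDl.
have m0 : 0 < a * c / 4%:R / (K + 1) by rewrite !divr_gt0 ?mulr_gt0.
exists (Num.min s1 (a * c / 4%:R / (K + 1))); first by rewrite lt_min s10.
move=> s z; rewrite lt_min => /and3P[s0 h1 h2] hz.
have [|h3 _ _] := hK s _ z z hz hz; first by rewrite s0.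
have h4 : K * s ^+ 2 <= a * c / 4%:R.
  rewrite ltr_pdivlMr // in h2; apply: le_trans (ltW h2).
  rewrite mulrC expr2 -mulrA ler_wpM2l ?(ltW s0) //.
  apply: (@le_trans _ _ (1 * K)); last by rewrite mul1r lerDl.
  by rewrite ler_wpM2r // (le_trans (ltW h1)).
set q := _ / _ in h3 *.
have h5 : a * (c / 2%:R) <= normc (a%:C * z).
  by rewrite Normc.normcM normcR gtr0_norm // ler_wpM2l ?(ltW a0) // near_center_ge.
have := normcD q (a%:C * z - q); rewrite addrC subrK normc_distC.
by move: h3 h4 h5; normc_lra.
Qed.

Lemma Csin_neq0_near : exists2 s2 : R, 0 < s2 &
  forall s z, 0 < s < s2 -> U z -> Csin (x s z) != 0.
Proof.
have [s2 s20 h] := q_ge; exists s2 => // s z hs hz; apply/eqP => e.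
have := h s z hs hz; rewrite e mul0r Normc.normc0 leNgt.
by rewrite !divr_gt0 ?mulr_gt0.
Qed.

(** The linear terms of the numerator cancel, so it is O(s^3). After division of both parts by s,
    the numerator has order 2 and the denominator is bounded away from 0. *)
Lemma slip_xcot_sub1 : slip U 2 xcot_sub1.
Proof.
have hx := slip_linear hU a%:C.
have hS := slip_Csin hU a; have hC := slip_Ccos hU a.
have hn : slip U (2 + 1) (fun s z => x s z * Ccos (x s z) - Csin (x s z)).
  apply: slip_ext (slipB (slip_le (_ : (3 <= 5)%N) (slipB (slipM hx hC) hS))
    (slipMl 3%:R^-1 (slipX 3 hx))) _ => // s z _ _.
  by rewrite /x; field.
have hq : slip U 0 (fun s z => Csin (x s z) / s%:C ^+ 1).
  apply: slip_ext (slipD (slip_le (_ : (0 <= 2)%N) q_err) (slipMl a%:C (slip_var hU))) _ => //.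
  by move=> s z _ _; rewrite subrK.
have [s2 s20 hge] := q_ge.
have hqV := slipV (_ : 0 < a * c / 4%:R) s20 hge hq.
apply: slip_ext (slipM (slip_div_scale hn) (hqV _)) _; first by rewrite divr_gt0 ?mulr_gt0.
move=> s z /andP[s0 _] hz; rewrite /xcot_sub1 expr1 invfM invrK mulrACA.
by rewrite mulVf ?mulr1 // real_complex_neq0.
Qed.

End InnerLayer.

Variables (R1 R2 tau : R) (beta : R -> R[i] -> R[i]).
Hypotheses (R10 : 0 < R1) (hc : c ^+ 2 * (R1 ^+ 3 - R2 ^+ 3) = 3%:R * R1).
Hypothesis hbeta : slip U 2 beta.

Let y (r s : R) (z : R[i]) := s%:C * r%:C * z.
Let F s z := reduced_det (y R1 s z) (y R2 s z) (y (R1 / tau) s z) (beta s z) (s%:C ^+ 2).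

(** With th = y_1 - y_2, the part free of delta starts with y_1 y_2 th + th^3 / 3 = (y_1^3 - y_2^3)
    / 3, and the part linear in delta with -delta (1 - i x_1) (th + y_2) = -delta (1 - i x_1)
    y_1. *)
Lemma slip_reduced_det : slip U 5 (fun s z => F s z -
  ((R1%:C ^+ 3 - R2%:C ^+ 3) / 3%:R * (s%:C * z) ^+ 3
   - s%:C ^+ 3 * R1%:C * z * (1 - 'i * y (R1 / tau) s z))).
Proof.
pose th := y (R1 - R2).
have hy r : slip U 1 (y r) := slip_linear hU r%:C.
have hS := slip_Csin hU (R1 - R2); have hC := slip_Ccos hU (R1 - R2).
pose S s z := Csin (th s z) - th s z + th s z ^+ 3 / 6%:R.
pose C s z := Ccos (th s z) - 1 + th s z ^+ 2 / 2%:R.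
pose A s z := 1 - 'i * y (R1 / tau) s z.
have {}hS : slip U 5 S := hS.
have {}hC : slip U 4 C := hC.
have hA : slip U 0 A.
  exact: slipB (slip_cst U 1) (slip_le (leq0n 1) (slipMl 'i%R (hy _))).
have hd : slip U 2 (fun s _ => s%:C ^+ 2) := slipX 2 (slip_scale U).
have h2 : slip U 2 (fun s z => th s z ^+ 2) := slipX 2 (hy _).
have h3 : slip U 3 (fun s z => th s z ^+ 3) := slipX 3 (hy _).
have hyy : slip U 2 (fun s z => y R1 s z * y R2 s z) := slipM (hy R1) (hy R2).
(* The remainders are sorted by origin: [t1] is free of delta, [t2] contains only [A], [t3] only
   [beta], and [t4] their product, of order 7. *)
have t1 : slip U 5 (fun s z => - 6%:R^-1 * (y R1 s z * y R2 s z * th s z ^+ 3)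
    + (1 + y R1 s z * y R2 s z) * S s z - th s z * C s z).
  apply: slipB (slipM (hy _) hC); apply: slipD; first exact: slipMl (slipM hyy h3).
  exact: slipM (slipD (slip_cst U 1) (slip_le (leq0n 2) hyy)) hS.
have t2 : slip U 5 (fun s z => s%:C ^+ 2 * A s z *
    (S s z - 6%:R^-1 * th s z ^+ 3 + y R2 s z * (C s z - 2%:R^-1 * th s z ^+ 2))).
  apply: (slipM (n := 2) (m := 3)); first exact: (slipM hd hA).
  apply: slipD; first exact: slipB (slip_le (_ : (3 <= 5)%N) hS) (slipMl _ h3).
  exact: slipM (hy _) (slipB (slip_le (_ : (2 <= 4)%N) hC) (slipMl _ h2)).
have hsin : slip U 1 (fun s z => S s z + th s z - 6%:R^-1 * th s z ^+ 3).
  apply: slipB (slip_le (_ : (1 <= 3)%N) (slipMl _ h3)) => //.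
  exact: slipD (slip_le (_ : (1 <= 5)%N) hS) (hy _).
have hcos : slip U 0 (fun s z => C s z + 1 - 2%:R^-1 * th s z ^+ 2).
  apply: slipB (slip_le (leq0n 2) (slipMl _ h2)).
  exact: slipD (slip_le (leq0n 4) hC) (slip_cst U 1).
have t3 : slip U 5 (fun s z => s%:C ^+ 2 * beta s z *
    (S s z + th s z - 6%:R^-1 * th s z ^+ 3
     - y R1 s z * (C s z + 1 - 2%:R^-1 * th s z ^+ 2))).
  apply: (slipM (n := 4) (m := 1)); first exact: (slipM hd hbeta).
  exact: slipB hsin (slipM (hy _) hcos).
have t4 : slip U 5 (fun s z => s%:C ^+ 2 * s%:C ^+ 2 * A s z * beta s z *
    (S s z + th s z - 6%:R^-1 * th s z ^+ 3)).
  apply: (slip_le (_ : (5 <= 7)%N)) => //.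
  exact: slipM (slipM (slipM (slipM hd hd) hA) hbeta) hsin.
apply: slip_ext (slipB (slipD (slipB t1 t2) t3) t4) _ => s z _ _.
have eth : y R1 s z - y R2 s z = th s z by rewrite /th /y rmorphB; ring.
rewrite /F /reduced_det eth -/(A s z) /S /C.
have -> : (R1%:C ^+ 3 - R2%:C ^+ 3) / 3%:R * (s%:C * z) ^+ 3 =
    (y R1 s z ^+ 3 - y R2 s z ^+ 3) / 3%:R by rewrite /y; field.
have -> : s%:C ^+ 3 * R1%:C * z = s%:C ^+ 2 * y R1 s z by rewrite /y; ring.
move: eth; move: (y R1 s z) (y R2 s z) (A s z) (beta s z) => y1 y2 a be eth.
move: (Csin _) (Ccos _) => sn cs; rewrite -eth.
by field.
Qed.

Lemma reduced_det_root : exists s1 K : R, exists Z : R -> R[i], 0 < s1 /\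
  forall s, 0 < s < s1 ->
  [/\ U (Z s), F s (Z s) = 0,
      normc (Z s - (c%:C - 'i * (c ^+ 2 * (R1 / tau) / 2%:R * s)%:C)) <= K * s ^+ 2 &
      ccont Z s].
Proof.
pose M := (R1%:C ^+ 3 - R2%:C ^+ 3) / 3%:R : R[i].
have hM : c%:C ^+ 2 * M = R1%:C.
  rewrite /M -!rmorphXn -rmorphB mulrA -rmorphM hc rmorphM rmorph_nat mulrAC.
  by rewrite divff ?mul1r // pnatr_eq0.
have M0 : M != 0.
  have := real_complex_neq0 R10; rewrite -hM; apply: contraNneq => ->.
  by rewrite mulr0.
(* Chosen so that z^2 = c^2 + G amounts to F = 0. Because c^2 M = R_1, the first-order term of [G]
   is -i c^2 (R_1 / tau) s z. *)
pose G s z := z ^+ 2 - c%:C ^+ 2 - F s z / (M * s%:C ^+ 3 * z).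
have hG : slip U 2 (fun s z => G s z + 'i * (c ^+ 2 * (R1 / tau))%:C * s%:C * z).
  apply: slip_ext (slipMl (- M^-1)
    (slipM (slip_div_scale (n := 2) (m := 3) slip_reduced_det) slip_near_center_inv)) _.
  move=> s z /andP[s0 _] hz; rewrite /G -/M /y -hM.
  have -> : (c ^+ 2 * (R1 / tau))%:C = c%:C ^+ 2 * (R1 / tau)%:C :> R[i].
    by rewrite rmorphM rmorphXn.
  have z0 := near_center_neq0 hz; have sn := real_complex_neq0 s0.
  by move: ((R1 / tau)%:C) => q; field; rewrite z0 sn M0.
have [s1 [K [Z [s10 hZ]]]] := perturbed_root c0 hG.
exists s1, K, Z; split=> // s hs; have [h1 h2 h3 h4] := hZ s hs; split=> //.
have /andP[s0 _] := hs.
have z0 := near_center_neq0 h1; have sn := real_complex_neq0 s0.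
have e : F s (Z s) / (M * s%:C ^+ 3 * Z s) = 0.
  have -> : F s (Z s) / (M * s%:C ^+ 3 * Z s) = Z s ^+ 2 - c%:C ^+ 2 - G s (Z s).
    by rewrite /G opprB addrC subrK.
  by rewrite h2 [_ + G _ _]addrC addrK subrr.
have nz := mulf_neq0 (mulf_neq0 M0 (expf_neq0 3 sn)) z0.
by rewrite -(divfK nz (F s (Z s))) e mul0r.
Qed.

End Asymptotics.

(** * Return from s to delta = s^2 *)

Section SquareRootScale.
Variable R : realType.

(** The factor s = sqrt d in w = s Z(s) turns the O(s^2) error into O(d sqrt d); Re Z >= 3 c / 4
    makes the real part of [w] positive. *)
Lemma unscale_root (c b s1 K : R) (Z : R -> R[i]) : 0 < c -> 0 < s1 ->
  (forall s, 0 < s < s1 -> [/\ normc (Z s - c%:C) <= c / 4%:R,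
     normc (Z s - (c%:C - 'i * (b * s)%:C)) <= K * s ^+ 2 & ccont Z s]) ->
  let w d := (Num.sqrt d)%:C * Z (Num.sqrt d) in
  ccont_on (s1 ^+ 2) w /\ forall d, 0 < d < s1 ^+ 2 ->
    [/\ w d != 0, 0 < complex.Re (w d) &
    normc (w d - ((c * Num.sqrt d) +i* (- b * d))) <= K * (d * Num.sqrt d)].
Proof.
move=> c0 s10 hZ w.
have hs d : 0 < d < s1 ^+ 2 -> 0 < Num.sqrt d < s1.
  move=> /andP[d0 d1]; rewrite sqrtr_gt0 d0 /=.
  by rewrite -(gtr0_norm s10) -sqrtr_sqr ltr_sqrt // exprn_gt0.
split.
- move=> d hd e e0; have /andP[d0 d1] := hd.
  have [_ _ cZ] := hZ _ (hs d hd).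
  have csq : {for d, continuous (@Num.sqrt R)} by apply: sqrt_continuous.
  have cw : ccont w d.
    apply: ccontM; first exact: ccont_real.
    case: cZ => z1 z2.
    by split; [exact: (continuous_comp csq z1) | exact: (continuous_comp csq z2)].
  have [eta eta0 heta] := (proj1 (ccontP _ _) cw) e e0.
  by exists eta => // d' _; exact: heta.
move=> d hd; have hsd := hs d hd; have [h1 h2 _] := hZ _ hsd.
have /andP[d0 _] := hd; have /andP[q0 _] := hsd.
have ReZ : 0 < complex.Re (Z (Num.sqrt d)).
  have := le_trans (Re_le_normc _) h1; rewrite Re_sub /= ler_norml => /andP[+ _].
  by move: c0; lra.
have Rew : 0 < complex.Re (w d) by rewrite /w Re_mul /= mul0r subr0 mulr_gt0.
split=> //; first by apply/eqP => e; move: Rew; rewrite e ltxx.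
have -> : w d - ((c * Num.sqrt d) +i* (- b * d)) =
    (Num.sqrt d)%:C * (Z (Num.sqrt d) - (c%:C - 'i * (b * Num.sqrt d)%:C)).
  have -> : (c * Num.sqrt d) +i* (- b * d) =
      (Num.sqrt d)%:C * (c%:C - 'i * (b * Num.sqrt d)%:C).
    rewrite -[X in - b * X](sqr_sqrtr (ltW d0)); move: (Num.sqrt d) => q.
    have Re_i : complex.Re ('i%R : R[i]) = 0 by [].
    have Im_i : complex.Im ('i%R : R[i]) = 1 by [].
    apply/eqP; rewrite eq_complex !(Re_mul, Im_mul, Re_sub, Im_sub) Re_i Im_i /=.
    by apply/andP; split; apply/eqP; ring.
  by rewrite [RHS]mulrBr.
rewrite Normc.normcM normcR gtr0_norm //.
have -> : K * (d * Num.sqrt d) = Num.sqrt d * (K * Num.sqrt d ^+ 2).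
  by rewrite sqr_sqrtr ?(ltW d0) //; ring.
by rewrite ler_pM2l.
Qed.

End SquareRootScale.

(** * The solid ball and the spherical shell *)

Theorem mainTheorem3 (R : realType) (vr v : R) (hvr : 0 < vr) (hv : 0 < v) :
  (* (i) N = 1 *)
  (forall r : nat -> R, 0 < r 1%N ->
    exists2 d0 : R, 0 < d0 &
    exists w : R -> R[i], exists C : R,
      ccont_on d0 w /\
      forall d : R, 0 < d < d0 ->
        \det (transA vr v r d (w d) 1) = 0 /\ 0 < complex.Re (w d) /\
        Normc.normc (w d -
          ((Num.sqrt 3%:R * vr / r 1%N * Num.sqrt d)
           +i* (- (3%:R * vr / (2%:R * (v / vr) * r 1%N)) * d)))
          <= C * (d * Num.sqrt d))
  /\
  (* (ii) N = 2 *)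
  (forall r : nat -> R, 0 < r 2%N -> r 2%N < r 1%N ->
    exists2 d0 : R, 0 < d0 &
    exists w : R -> R[i], exists C : R,
      ccont_on d0 w /\
      forall d : R, 0 < d < d0 ->
        \det (transA vr v r d (w d) 2) = 0 /\ 0 < complex.Re (w d) /\
        Normc.normc (w d -
          ((Num.sqrt (3%:R * r 1%N) * vr / Num.sqrt (r 1%N ^+ 3 - r 2%N ^+ 3) * Num.sqrt d)
           +i* (- (3%:R * r 1%N ^+ 2 * vr
                   / (2%:R * (v / vr) * (r 1%N ^+ 3 - r 2%N ^+ 3))) * d)))
          <= C * (d * Num.sqrt d)).
Proof.
have vr0 : vr != 0 by rewrite gt_eqF.
have v0 : v != 0 by rewrite gt_eqF.
have vrC : vr%:C != 0 :> R[i] := real_complex_neq0 hvr.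
have vC : v%:C != 0 :> R[i] := real_complex_neq0 hv.
have y_eq (t s : R) (z : R[i]) : s%:C * (t / vr)%:C * z = s%:C * z / vr%:C * t%:C.
  by rewrite rmorphM fmorphV; ring.
have x_eq (t s : R) (z : R[i]) : s%:C * (t / vr / (v / vr))%:C * z = s%:C * z / v%:C * t%:C.
  have -> : t / vr / (v / vr) = t / v by field; rewrite vr0 v0.
  by rewrite rmorphM fmorphV; ring.
split=> r.
- move=> r10; set r1 := r 1%N in r10 *.
  have r1n : r1 != 0 by rewrite gt_eqF.
  set c := Num.sqrt 3%:R * vr / r1.
  have c0 : 0 < c by rewrite !mulr_gt0 ?invr_gt0 ?sqrtr_gt0.
  have c2 : c ^+ 2 = 3%:R * vr ^+ 2 / r1 ^+ 2.
    by rewrite !exprMn sqr_sqrtr // exprVn.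
  (* The solid ball is the instance R_2 = 0 with [beta] identically 0. *)
  have hc : c ^+ 2 * ((r1 / vr) ^+ 3 - 0 ^+ 3) = 3%:R * (r1 / vr).
    by rewrite c2; field; rewrite vr0 r1n.
  have hR1 : 0 < r1 / vr by rewrite divr_gt0.
  have hbeta : slip (fun z : R[i] => normc (z - c%:C) <= c / 4%:R) 2 (fun _ _ => 0).
    exists 0, 1; split=> // s _ z w _ _; rewrite subrr Normc.normc0 !mul0r.
    by split=> //; exact: ccont_cst.
  have [s1 [K [Z [s10 hZ]]]] := reduced_det_root c0 (v / vr) hR1 hc hbeta.
  have [|hcont hw] := @unscale_root R c (c ^+ 2 * (r1 / vr / (v / vr)) / 2%:R) s1 K Z c0 s10.
    by move=> s hs; have [h1 _ h3 h4] := hZ s hs; split.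
  exists (s1 ^+ 2); first by rewrite exprn_gt0.
  exists (fun d => (Num.sqrt d)%:C * Z (Num.sqrt d)), K; split=> // d hd.
  have [wn0 Re0 hest] := hw d hd; have /andP[d0 d1] := hd.
  split; last split=> //.
  + apply: det_transA1 => //.
    have hsd : 0 < Num.sqrt d < s1.
      rewrite sqrtr_gt0 d0 /= -(gtr0_norm s10) -sqrtr_sqr ltr_sqrt // exprn_gt0 //.
    have [_ + _ _] := hZ _ hsd.
    rewrite y_eq x_eq rmorph0 mulr0 mul0r -rmorphXn sqr_sqrtr ?ltW //.
  + apply: le_trans hest; rewrite le_eqVlt; apply/orP; left; apply/eqP.
    congr (normc (_ - (_ +i* (- _ * _)))).
    by rewrite c2; field; rewrite vr0 v0 r1n.
- move=> r20 r21; set r1 := r 1%N in r21 *; set r2 := r 2%N in r20 r21 *.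
  have r10 : 0 < r1 := lt_trans r20 r21.
  have r3 : 0 < r1 ^+ 3 - r2 ^+ 3 by rewrite subr_gt0 ltrXn2r // ltW.
  have r3n : r1 ^+ 3 - r2 ^+ 3 != 0 by rewrite gt_eqF.
  have r1n : r1 != 0 by rewrite gt_eqF.
  set c := Num.sqrt (3%:R * r1) * vr / Num.sqrt (r1 ^+ 3 - r2 ^+ 3).
  have c0 : 0 < c by rewrite !mulr_gt0 ?invr_gt0 ?sqrtr_gt0 ?mulr_gt0.
  have c2 : c ^+ 2 = 3%:R * r1 * vr ^+ 2 / (r1 ^+ 3 - r2 ^+ 3).
    by rewrite !exprMn sqr_sqrtr ?mulr_ge0 ?(ltW r10) // exprVn sqr_sqrtr // ltW.
  have hc : c ^+ 2 * ((r1 / vr) ^+ 3 - (r2 / vr) ^+ 3) = 3%:R * (r1 / vr).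
    by rewrite c2; field; rewrite vr0 r3n.
  have hR1 : 0 < r1 / vr by rewrite divr_gt0.
  have a0 : 0 < r2 / vr / (v / vr) by rewrite !divr_gt0.
  (* Below [s2] the sine of x_2 is nonzero, so [xcot_sub1] satisfies the equation that [det_transA2]
     asks of [beta]; hence the smaller threshold [s3]. *)
  have [s2 s20 hsin] := Csin_neq0_near c0 a0.
  have [s1 [K [Z [s10 hZ]]]] :=
    reduced_det_root c0 (v / vr) hR1 hc (slip_xcot_sub1 c0 a0).
  pose s3 := Num.min s1 s2.
  have s30 : 0 < s3 by rewrite lt_min s10.
  have [|hcont hw] := @unscale_root R c (c ^+ 2 * (r1 / vr / (v / vr)) / 2%:R) s3 K Z c0 s30.
    move=> s; rewrite lt_min => /and3P[h h' _].
    by have [|h1 _ h3 h4] := hZ s; [rewrite h|split].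
  exists (s3 ^+ 2); first by rewrite exprn_gt0.
  exists (fun d => (Num.sqrt d)%:C * Z (Num.sqrt d)), K; split=> // d hd.
  have [wn0 Re0 hest] := hw d hd; have /andP[d0 d1] := hd.
  split; last split=> //.
  + have : 0 < Num.sqrt d < s3.
      rewrite sqrtr_gt0 d0 /= -(gtr0_norm s30) -sqrtr_sqr ltr_sqrt // exprn_gt0 //.
    rewrite lt_min => /and3P[q0 q1 q2].
    have [|hU + _ _] := hZ (Num.sqrt d); first by rewrite q0.
    have := hsin (Num.sqrt d) (Z (Num.sqrt d)); rewrite q0 q2 => /(_ isT hU).
    rewrite /xcot_sub1 !y_eq !x_eq -rmorphXn sqr_sqrtr ?(ltW d0) // => sn0.
    by apply: det_transA2 => //; rewrite divfK.
  + apply: le_trans hest; rewrite le_eqVlt; apply/orP; left; apply/eqP.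
    congr (normc (_ - (_ +i* (- _ * _)))).
    by rewrite c2; field; rewrite vr0 v0 r3n.
Qed.
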